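(* Let $n>2$ be an integer and let $f\in C^{1}(0,\infty)\cap C[0,\infty)$ be a real-valued function having at least one zero in $[0,\infty)$. Suppose that for some $\beta\in\left(1,\frac{n+2}{n-2}\right)$, $$\beta f(s)-s f'(s)\ge 0\quad\text{for all } s>0,$$ and that $$|f(s)|\ge c_{1}s^{\beta}\quad\text{for all } s>0,$$ where $c_{1}$ is some positive constant depending on $n,\beta$. Then the equation $$\Delta u+f(u)=0\quad\text{in }\mathbb{R}^{n}$$ only admits the trivial solution $u\equiv 0$; that is, it has no smooth positive solution, and $u\equiv 0$ is its only trivial (nonnegative constant) solution.
   Context: $\Delta$ is the usual Laplacian on $\mathbb{R}^n$. Solutions are classical and defined on all of $\mathbb{R}^n$; a positive solution is one with $u(x)>0$ for every $x\in\mathbb{R}^n$. The function $f$ is allowed to change sign. *)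

(* Defs.v *)
From HB Require Import structures.
From mathcomp Require Import all_boot all_order all_algebra.
From mathcomp Require Import all_classical all_reals all_analysis.

Set Implicit Arguments.
Unset Strict Implicit.
Unset Printing Implicit Defensive.
Import Order.TTheory GRing.Theory Num.Theory.
Import numFieldNormedType.Exports.

Local Open Scope classical_set_scope.
Local Open Scope ring_scope.

Section euclidean_calculus.
Context {R : realType} {n : nat}.
Implicit Types (u : 'rV[R]_n -> R) (i : 'I_n).

Definition partial i u : 'rV[R]_n -> R := 'D_(delta_mx 0 i) u.

(* ['D_v u x] is a total function, so the existence of the derivative has to be
   required separately. *)
Definition C1 u : Prop :=
  forall i, (forall x, derivable u x (delta_mx 0 i)) /\ continuous (partial i u).

Definition C2 u : Prop := C1 u /\ forall i, C1 (partial i u).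

Definition laplacian u (x : 'rV[R]_n) : R := \sum_(i < n) partial i (partial i u) x.

(* The values of [f] on ]-oo, 0[ play no role when [u] is nonnegative. *)
Definition classical_solution (f : R -> R) u : Prop :=
  C2 u /\ forall x, laplacian u x + f (u x) = 0.

End euclidean_calculus.

(* Main.v *)
Require Import Defs.
From mathcomp Require Import all_boot all_order all_algebra.
From mathcomp Require Import all_classical all_reals all_analysis.
From mathcomp Require Import ring lra.
Import Order.TTheory GRing.Theory Num.Theory.
Import numFieldNormedType.Exports.

Local Open Scope classical_set_scope.
Local Open Scope ring_scope.

(** Write w = ln u, Q = |grad w|^2 and h(t) = f(e^t) e^(-t), so that
    Delta w = - Q - h(w), where h has a constant sign, |h(t)| >= c1 e^(b t) and
    h' <= b h for b = beta - 1 > 0.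

    If h < 0, the maximum of e^(b w / 2) (1 - |x|^2 / B) over the ball gives
    e^(b w(0)) = O(1/B), the Keller-Osserman argument.

    If h > 0, let F = e^(- s w) Q + N(w) with N' = 2 tau e^(- s t) h and
    0 < N(w(0)).  Bernstein's method at a maximum point x0 of (1 - |x|^2/B)^2 F
    yields N(w(0)) <= K e^(- s w(x0)) / B: for s < 2/(n-2) and tau < 1/n close to
    these values the quadratic form in (Q, h) produced by Bochner's formula is
    positive definite exactly because b < 4/(n-2).  Since u is superharmonic,
    u >= c |x|^(- 2 k) at infinity for every k > (n-2)/2, so the right-hand side
    is O(B^(s k - 1)) with s k < 1, and B -> oo is a contradiction.

    Bochner's formula needs third derivatives of u, which a C^2 solution need not
    have; Q is therefore replaced by a sum of squared difference quotients of w,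
    whose Laplacian only involves Hess w and difference quotients of Delta w. *)

Set Implicit Arguments.
Unset Strict Implicit.
Unset Printing Implicit Defensive.

(** * Directional derivatives and the derivative tests at a maximum *)

Lemma is_derive_continuous (R : realType) (f f1 : R -> R) :
  (forall t : R, is_derive t (1 : R) f (f1 t)) -> continuous f.
Proof. by move=> df t; apply/differentiable_continuous/derivable1_diffP/ex_derive. Qed.

Section directional.
Context {R : realType} {V : normedModType R}.
Implicit Types (f g : V -> R) (x v : V).

Lemma is_derive_line f x v (t df : R) :
  is_derive (x + t *: v) v f df ->
  is_derive t 1 (fun s : R => f (x + s *: v)) df.
Proof.
move=> [dfx <-].
have E : (fun h : R => h^-1 *: ((fun s : R => f (x + s *: v)) (h *: 1 + t)
            - f (x + t *: v))) =
         (fun h : R => h^-1 *: (f (h *: v + (x + t *: v)) - f (x + t *: v))).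
  apply/funext => h /=; congr (_ *: (f _ - _)).
  by rewrite [h *: 1]mulr1 scalerDl addrCA addrA [_ + x]addrC.
by apply: DeriveDef; rewrite /derivable /derive /= E.
Qed.

Lemma line_is_derive f x v df :
  is_derive (0 : R) 1 (fun s : R => f (x + s *: v)) df -> is_derive x v f df.
Proof.
have E : (fun h : R => h^-1 *: ((fun s : R => f (x + s *: v)) (h *: 1 + 0)
            - f (x + 0 *: v))) =
         (fun h : R => h^-1 *: (f (h *: v + x) - f x)).
  apply/funext => h /=; congr (_ *: (f _ - f _)).
    by rewrite [h *: 1]mulr1 addr0 addrC.
  by rewrite scale0r addr0.
move=> [dfx <-]; apply: DeriveDef.
  by move: dfx; rewrite /derivable /= E.
by rewrite /derive /= E.
Qed.

(** Restricting [f] to the line [x + s *: v] turns this into the one-variable chain rule.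
    Derivability along single directions is what [C1] and [C2] supply, so the calculus below is
    built on it. *)
Lemma is_derive_comp (phi : R -> R) f x v dphi df :
  is_derive (f x) 1 phi dphi -> is_derive x v f df ->
  is_derive x v (fun y => phi (f y)) (dphi * df).
Proof.
move=> dp fx; apply: line_is_derive.
have -> : (fun s : R => phi (f (x + s *: v))) = phi \o (fun s => f (x + s *: v)) by [].
apply: is_derive1_comp; first by rewrite scale0r addr0.
by apply: is_derive_line; rewrite scale0r addr0.
Qed.

Lemma pd_cst (c : R) x v : is_derive x v (fun=> c) 0.
Proof. exact: is_derive_cst. Qed.

Lemma pd_add f g x v df dg : is_derive x v f df -> is_derive x v g dg ->
  is_derive x v (fun y => f y + g y) (df + dg).
Proof. exact: is_deriveD. Qed.

Lemma pd_opp f x v df : is_derive x v f df -> is_derive x v (fun y => - f y) (- df).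
Proof. exact: is_deriveN. Qed.

Lemma pd_sub f g x v df dg : is_derive x v f df -> is_derive x v g dg ->
  is_derive x v (fun y => f y - g y) (df - dg).
Proof. by move=> hf hg; apply: pd_add => //; exact: pd_opp. Qed.

Lemma pd_mul f g x v df dg : is_derive x v f df -> is_derive x v g dg ->
  is_derive x v (fun y => f y * g y) (f x * dg + g x * df).
Proof. exact: is_deriveM. Qed.

Lemma pd_sqr f x v df : is_derive x v f df ->
  is_derive x v (fun y => f y ^+ 2) (2 * f x * df).
Proof.
move=> h; rewrite (_ : (fun y => _) = fun y => f y * f y); last first.
  by apply/funext => y; rewrite expr2.
by apply: (is_derive_eq (pd_mul h h)); ring.
Qed.

Lemma pd_sum (I : finType) (F : I -> V -> R) x v (dF : I -> R) :
  (forall i, is_derive x v (F i) (dF i)) ->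
  is_derive x v (fun y => \sum_i F i y) (\sum_i dF i).
Proof.
move=> h.
have -> : (fun y => \sum_i F i y) = \sum_i F i.
  by apply/funext => y; rewrite fct_sumE.
elim/big_ind2 : _ => // [|*]; [exact: is_derive_cst|exact: is_deriveD].
Qed.

Lemma pd_exp f x v df : is_derive x v f df ->
  is_derive x v (fun y => expR (f y)) (expR (f x) * df).
Proof. by move=> h; apply: is_derive_comp. Qed.

(** If [d] were positive, [f1] would be positive just beyond [x0] along [v], and the mean value
    theorem would push [f] above its maximum. Only the derivative of [f1] at [x0] itself enters. *)
Lemma local_max_second_order (f f1 : V -> R) (v x0 : V) (d r : R) :
  0 < r -> (forall y, is_derive y v f (f1 y)) -> is_derive x0 v f1 d ->
  (forall x, ball x0 r x -> f x <= f x0) -> f1 x0 = 0 /\ d <= 0.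
Proof.
move=> r0 df df1 fmax.
(* The [1 +] keeps the divisor positive when [v = 0]. *)
pose s : R := r / (1 + `|v|).
have v1 : 0 < 1 + `|v| by rewrite ltr_pwDl.
have s0 : 0 < s by rewrite divr_gt0.
have inball (t : R) : `|t| < s -> ball x0 r (x0 + t *: v).
  move=> ts; rewrite -ball_normE /= opprD addNKr normrN normrZ.
  have : `|t| * (1 + `|v|) < r by rewrite -ltr_pdivlMr.
  by apply: le_lt_trans; rewrite ler_wpM2l // lerDr.
pose phi t := f (x0 + t *: v); pose phi1 t := f1 (x0 + t *: v).
have dphi t : is_derive t (1 : R) phi (phi1 t) by exact: is_derive_line.
have phimax t : `|t| < s -> phi t <= phi 0.
  by move=> ts; rewrite /phi scale0r addr0; apply/fmax/inball.
have phi10 : phi1 0 = 0.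
  have [] : is_derive (0 : R) 1 phi 0.
    apply: (@derive1_at_max R phi (- s) s).
    - lra.
    - by move=> t _; apply: ex_derive.
    - by rewrite in_itv /= oppr_lt0 s0.
    - by move=> t; rewrite in_itv /= => /andP[h1 h2]; apply: phimax; rewrite ltr_norml h1.
  by have [_ <-] := dphi 0 => _ ->.
have df10 : f1 x0 = 0 by move: phi10; rewrite /phi1 scale0r addr0.
split=> //; rewrite leNgt; apply/negP => d0.
have dphi1 : is_derive (0 : R) 1 phi1 d by apply: is_derive_line; rewrite scale0r addr0.
have [dv de] := dphi1.
have hc : h^-1 *: (phi1 (h *: 1 + 0) - phi1 0) @[h --> (0:R)^'] --> d.
  by rewrite -de; exact: dv.
have /nbhs_ballP[e /= e0 he] : \forall h \near (0:R)^', 0 < h^-1 *: (phi1 (h *: 1 + 0) - phi1 0).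
  exact: (cvgr_gt _ hc).
pose t := Num.min e s / 2.
have m0 : 0 < Num.min e s by rewrite lt_min e0.
have t0 : 0 < t by rewrite divr_gt0.
have te : t < e by apply: (@lt_le_trans _ _ (Num.min e s)); [rewrite /t; lra|rewrite ge_min lexx].
have ts : t < s by apply: (@lt_le_trans _ _ (Num.min e s)); [rewrite /t; lra|rewrite ge_min lexx orbT].
have pos c : 0 < c -> c <= t -> 0 < phi1 c.
  move=> c0 ct; have : ball (0:R) e c.
    by rewrite -ball_normE /= sub0r normrN gtr0_norm // (le_lt_trans ct).
  move=> /he /(_ (lt0r_neq0 c0)).
  by rewrite phi10 subr0 addr0 [c *: 1]mulr1 pmulr_rgt0 // invr_gt0.
have [c] := @MVT R phi phi1 0 t t0 (fun z _ => dphi z)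
   (continuous_subspaceT (is_derive_continuous dphi)).
rewrite in_itv /= => /andP[c0 ct] E.
have := phimax t; rewrite gtr0_norm // => /(_ ts).
by rewrite -subr_le0 E subr0 leNgt mulr_gt0 // (pos c c0 (ltW ct)).
Qed.

Lemma derive_mvt (f f1 : V -> R) (v x : V) (h : R) :
  (forall y, is_derive y v f (f1 y)) -> 0 < h ->
  exists t, [/\ 0 < t, t < h & f (x + h *: v) - f x = f1 (x + t *: v) * h].
Proof.
move=> df h0; pose phi t := f (x + t *: v); pose phi1 t := f1 (x + t *: v).
have dphi t : is_derive t (1 : R) phi (phi1 t) by exact: is_derive_line.
have [c] := @MVT R phi phi1 0 h h0 (fun z _ => dphi z)
   (continuous_subspaceT (is_derive_continuous dphi)).
rewrite in_itv /= => /andP[c0 ct] E; exists c; split=> //.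
by move: E; rewrite /phi scale0r addr0 subr0.
Qed.

End directional.

(** * Closure properties of continuous real-valued functions *)

Section continuous_algebra.
Context {R : realType} {T : topologicalType}.
Implicit Types f g : T -> R.

Lemma cts_cst (c : R) : continuous (fun _ : T => c).
Proof. by move=> x; exact: cvg_cst. Qed.

Lemma cts_add f g : continuous f -> continuous g -> continuous (fun x => f x + g x).
Proof. by move=> hf hg x; apply: cvgD; [exact: hf|exact: hg]. Qed.

Lemma cts_opp f : continuous f -> continuous (fun x => - f x).
Proof. by move=> hf x; apply: cvgN; exact: hf. Qed.

Lemma cts_mul f g : continuous f -> continuous g -> continuous (fun x => f x * g x).
Proof. by move=> hf hg x; apply: cvgM; [exact: hf|exact: hg]. Qed.

Lemma cts_sqr f : continuous f -> continuous (fun x => f x ^+ 2).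
Proof.
move=> hf; rewrite (_ : (fun x => _) = fun x => f x * f x); first exact: cts_mul.
by apply/funext => x; rewrite expr2.
Qed.

Lemma cts_norm f : continuous f -> continuous (fun x => `|f x|).
Proof. by move=> hf x; apply: cvg_norm; exact: hf. Qed.

Lemma cts_comp (phi : R -> R) f : continuous phi -> continuous f ->
  continuous (fun x => phi (f x)).
Proof. by move=> hp hf x; apply: continuous_comp; [exact: hf|exact: hp]. Qed.

Lemma cts_sum (I : finType) (F : I -> T -> R) :
  (forall i, continuous (F i)) -> continuous (fun z => \sum_i F i z).
Proof.
move=> h; apply: continuous_big => [|i _]; last exact: h.
exact: add_continuous.
Qed.

End continuous_algebra.

(** * Euclidean balls, and continuity from continuous partial derivatives *)

Section euclidean.
Context {R : realType} {n : nat}.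
Implicit Types (x y : 'rV[R]_n).
Local Notation V := 'rV[R]_n.
Local Notation e i := (delta_mx 0 i : 'rV[R]_n).

Lemma rV_ballP x y (r : R) :
  ball x r y <-> 0 < r /\ forall i, `|x 0 i - y 0 i| < r.
Proof.
split=> [[r0 h]|[r0 h]]; split=> //; first by move=> i; exact: h.
by move=> i j; rewrite ord1; apply: h.
Qed.

(** The norm on row vectors is the sup norm, so [ball] is a cube. The maximum arguments need a
    smooth radial function, hence the squared Euclidean distance. *)
Definition sqdist x y : R := \sum_i (y 0 i - x 0 i) ^+ 2.

Lemma sqdist_ge0 x y : 0 <= sqdist x y.
Proof. by apply: sumr_ge0 => i _; exact: sqr_ge0. Qed.

Lemma sqdistxx x : sqdist x x = 0.
Proof. by rewrite /sqdist big1 // => i _; rewrite subrr expr0n. Qed.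

Lemma continuous_sqdist x : continuous (sqdist x).
Proof.
apply: cts_sum => i; apply: cts_sqr; apply: cts_add; first exact: coord_continuous.
exact: cts_cst.
Qed.

Lemma coord_sqdist_le x y i : (y 0 i - x 0 i) ^+ 2 <= sqdist x y.
Proof.
rewrite /sqdist (bigD1 i) //= lerDl.
by apply: sumr_ge0 => j _; exact: sqr_ge0.
Qed.

Lemma sqdist_ball x y (r : R) : 0 < r -> sqdist x y < r ^+ 2 -> ball x r y.
Proof.
move=> r0 h; apply/rV_ballP; split=> // i.
have := le_lt_trans (coord_sqdist_le x y i) h.
rewrite distrC -real_normK ?num_real // => h2.
by rewrite -ltr_sqr // ?nnegrE ?normr_ge0 // ltW.
Qed.

Lemma sqdist_lt_nbhs x y (rho : R) : sqdist x y < rho ->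
  exists2 r, 0 < r & forall z, ball y r z -> sqdist x z < rho.
Proof.
move=> h; have /nbhs_ballP[r /= r0 hr] : \forall z \near y, sqdist x z < rho.
  exact: (cvgr_lt _ (@continuous_sqdist x y)).
by exists r => // z /hr.
Qed.

Lemma sqdist_ball_max (G : V -> R) x (rho : R) : continuous G -> 0 <= rho ->
  exists2 c, sqdist x c <= rho & forall y, sqdist x y <= rho -> G y <= G c.
Proof.
move=> cG rho0; pose K := [set y | sqdist x y <= rho].
have cK : closed K.
  by apply: (@closed_comp _ _ (sqdist x) [set t | t <= rho]) => [y _|];
    [exact: continuous_sqdist|exact: closed_le].
have bK : bounded_set K.
  (* Each coordinate of [y - x] is at most the square root of [rho], and [1 + rho] dominates that
     root. *)
  exists (`|x| + (1 + rho)); split; first exact: num_real.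
  move=> M hM y Ky /=.
  have M0 : 0 <= M by rewrite (le_trans _ (ltW hM)) // addr_ge0 // addr_ge0.
  rewrite [leLHS]mx_normrE; apply/bigmax_leP; split=> // -[i j] _ /=.
  rewrite ord1; apply: le_trans (ltW hM).
  have -> : y 0 j = x 0 j + (y 0 j - x 0 j) by ring.
  apply: le_trans (ler_normD _ _) _; apply: lerD.
    by rewrite [leRHS]mx_normrE (le_trans _ (le_bigmax _ _ (ord0, j))).
  have h : `|y 0 j - x 0 j| ^+ 2 <= rho.
    by rewrite real_normK ?num_real //; exact: le_trans (coord_sqdist_le _ _ _) _.
  have [h1|h1] := leP (`|y 0 j - x 0 j|) 1; first by lra.
  apply: le_trans (_ : `|y 0 j - x 0 j| ^+ 2 <= _); last by lra.
  by rewrite expr2 ler_peMr // ltW.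
have [c cK' cmax] := @EVT_max_rV R n G K (ex_intro _ x (eq_ind_r (fun t => t <= rho) rho0 (sqdistxx x)))
   (bounded_closed_compact bK cK) (continuous_subspaceT cG).
exists c; first by move: cK'; rewrite inE.
by move=> y hy; apply: cmax; rewrite inE.
Qed.

Lemma derive_bound (f f1 : V -> R) (v x : V) (h M : R) :
  (forall y, is_derive y v f (f1 y)) ->
  (forall t, `|t| <= `|h| -> `|f1 (x + t *: v)| <= M) ->
  `|f (x + h *: v) - f x| <= M * `|h|.
Proof.
move=> df; have [h0|h0|->] := ltgtP h 0 => hM; last first.
- by rewrite scale0r addr0 subrr normr0 mulr0.
- have [t [t0 th ->]] := derive_mvt x df h0.
  rewrite normrM ler_wpM2r // hM // !gtr0_norm // ltW //.
- have h0' : 0 < - h by lra.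
  have [t [t0 th]] := derive_mvt (x + h *: v) df h0'.
  rewrite -addrA -scalerDl subrr scale0r addr0 -addrA -scalerDl => E.
  rewrite distrC E normrM normrN ler_wpM2r // hM // (ltr0_norm h0) ltr0_norm; lra.
Qed.

(** Move from [x] to [y] one coordinate at a time: [z y k] has the first [k] coordinates of [y] and
    the others of [x]. Near [x] the partial derivatives are bounded by [M], so each move changes [f]
    by at most [M * s]. *)
Lemma partial_continuous (f : V -> R) (f1 : 'I_n -> V -> R) :
  (forall i x, is_derive x (e i) f (f1 i x)) ->
  (forall i, continuous (f1 i)) -> continuous f.
Proof.
move=> df cf1; suff H (x : V) : {for x, continuous f} by move=> x; exact: H.
pose M := 1 + \sum_i `|f1 i x|.
have M0 : 0 < M by rewrite ltr_pwDl // sumr_ge0.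
have /nbhs_ballP[r /= r0 hr] : \forall y \near x, forall i, `|f1 i y| < M.
  apply: (@filter_forall V 'I_n (fun i y => `|f1 i y| < M) (nbhs x) _) => i.
  have lt : `|f1 i x| < M.
    by rewrite /M (bigD1 i) //= addrCA ltrDl ltr_pwDl // sumr_ge0.
  exact: (cvgr_lt _ (cvg_norm (cf1 i x)) _ lt).
pose z y (k : nat) : V := \row_(j < n) if (j < k)%N then y 0 j else x 0 j.
have step y s : ball x s y -> s <= r -> forall k, (k <= n)%N ->
    `|f (z y k) - f x| <= k%:R * (M * s).
  move=> /rV_ballP[s0 hy] sr; elim=> [_|k IH kn].
    rewrite mul0r (_ : z y 0 = x) ?subrr ?normr0 //.
    by apply/rowP => j; rewrite mxE.
  have E : z y k.+1 = z y k + (y 0 (Ordinal kn) - x 0 (Ordinal kn)) *: e (Ordinal kn).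
    apply/rowP => j; rewrite !mxE eqxx /= ltnS leq_eqVlt.
    case: (eqVneq j (Ordinal kn)) => [->|ne] /=.
      by rewrite eqxx ltnn mulr1 /=; ring.
    rewrite mulr0 addr0; case: eqP => //= jk.
    by case/negP: ne; apply/eqP/val_inj.
  have -> : f (z y k.+1) - f x = (f (z y k.+1) - f (z y k)) + (f (z y k) - f x) by ring.
  apply: le_trans (ler_normD _ _) _.
  rewrite -natr1 mulrDl mul1r addrC lerD ?IH ?(ltnW kn) //.
  rewrite E; apply: le_trans (derive_bound (M := M) (df (Ordinal kn)) _) _; last first.
    by rewrite ler_wpM2l ?(ltW M0) // distrC ltW.
  move=> t ht; apply/ltW/hr; apply/rV_ballP; split=> // j; rewrite !mxE eqxx /=.
  case: (eqVneq j (Ordinal kn)) => [->|ne] /=.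
    rewrite ltnn mulr1 opprD addNKr normrN (le_lt_trans ht) //.
    by rewrite distrC (lt_le_trans (hy _)).
  rewrite mulr0 addr0; case: ifP => _; last by rewrite subrr normr0.
  by rewrite (lt_le_trans (hy _)).
apply/(@cvgrPdist_lt _ _ _ (nbhs x) (nbhs_filter x)) => eps eps0.
(* The [+ 1] makes the final inequality strict and covers [n = 0]. *)
pose s := Num.min r (eps / ((n%:R + 1) * M)).
have n1 : 0 < (n%:R + 1 : R) by rewrite ltr_wpDl.
have s0 : 0 < s by rewrite lt_min r0 divr_gt0 // mulr_gt0.
apply/nbhs_ballP; exists s => //= y hy.
have sr : s <= r by rewrite ge_min lexx.
have := step y s hy sr n (leqnn n).
have -> : z y n = y by apply/rowP => j; rewrite mxE ltn_ord.
rewrite distrC => /le_lt_trans; apply.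
have : (n%:R + 1) * M * s <= eps.
  by rewrite mulrC -ler_pdivlMr ?mulr_gt0 // ge_min lexx orbT.
apply: lt_le_trans; rewrite -mulrA ltr_pM2r ?mulr_gt0 //; lra.
Qed.

End euclidean.

(** * Derivatives of translates, coordinates and squared distances *)

Section shift_coord.
Context {R : realType} {n : nat}.
Local Notation V := 'rV[R]_n.

Lemma pd_shift (W : normedModType R) (f f1 : W -> R) (v c : W) :
  (forall y, is_derive y v f (f1 y)) ->
  forall y, is_derive y v (fun z => f (z + c)) (f1 (y + c)).
Proof.
move=> df y; apply: line_is_derive.
rewrite (_ : (fun s : R => _) = fun s => f ((y + c) + s *: v)).
  by apply: is_derive_line; rewrite scale0r addr0; exact: df.
by apply/funext => s; rewrite addrAC.
Qed.

Lemma pd_scale (W : normedModType R) (f : W -> R) (c : R) (x v : W) (df : R) :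
  is_derive x v f df -> is_derive x v (fun y => c * f y) (c * df).
Proof. by move=> h; apply: (is_derive_eq (pd_mul (pd_cst c x v) h)); rewrite mulr0 addr0. Qed.

Lemma pd_coord (i j : 'I_n) (x : V) :
  is_derive x 'e_i (fun y : V => y 0 j) (i == j)%:R.
Proof.
apply: line_is_derive.
rewrite (_ : (fun s : R => _) = fun s : R => (x 0 j) + (i == j)%:R * s).
  apply: (is_derive_eq (pd_add (pd_cst _ _ _) (pd_scale _ (is_derive_id _ _)))).
  by rewrite add0r mulr1.
by apply/funext => s; rewrite !mxE eqxx /= eq_sym mulrC.
Qed.

Lemma pd_sqdist (x0 : V) (i : 'I_n) (x : V) :
  is_derive x 'e_i (sqdist x0) (2 * (x 0 i - x0 0 i)).
Proof.
apply: (is_derive_eq (pd_sum (fun j => pd_sqr (pd_sub (pd_coord i j x) (pd_cst (x0 0 j) x 'e_i))))).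
rewrite (bigD1 i) //= eqxx subr0 mulr1 big1 ?addr0 // => j ji.
by rewrite eq_sym (negbTE ji) subr0 mulr0.
Qed.

End shift_coord.

(** * Bochner's inequality at a local maximum, through difference quotients *)

Section touching.
Context {R : realType} {n : nat}.
Local Notation V := 'rV[R]_n.
Implicit Types (x : V).

Lemma near_bounded (f : V -> R) x0 : continuous f ->
  exists C r, [/\ 0 < C, 0 < r & forall y, ball x0 r y -> `|f y| <= C].
Proof.
move=> cf; have lt : `|f x0| < 1 + `|f x0| by rewrite ltrDr.
have /nbhs_ballP[r /= r0 hr] : \forall y \near x0, `|f y| < 1 + `|f x0|.
  exact: (cvgr_lt _ (cvg_norm (cf x0)) _ lt).
exists (1 + `|f x0|), r; split; [by rewrite ltr_pwDl|by []|by move=> y /hr /ltW].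
Qed.

Lemma near_bounded_fin (I : finType) (f : I -> V -> R) x0 :
  (forall i, continuous (f i)) ->
  exists C r, [/\ 0 < C, 0 < r & forall i y, ball x0 r y -> `|f i y| <= C].
Proof.
move=> cf; have [|C [r [C0 r0 h]]] := @near_bounded (fun y => \sum_i `|f i y|) x0.
  by apply: cts_sum => i; exact: cts_norm.
exists C, r; split=> // i y /h; rewrite ger0_norm ?sumr_ge0 //.
by apply: le_trans; rewrite (bigD1 i) //= lerDl sumr_ge0.
Qed.

Variables (w : V -> R) (g : 'I_n -> V -> R) (H : 'I_n -> 'I_n -> V -> R).
Variables (psi : V -> R) (psi1 : 'I_n -> V -> R).
Variables (a b : V -> R) (a1 a2 b1 b2 : 'I_n -> V -> R).
Hypothesis dw : forall i x, is_derive x 'e_i w (g i x).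
Hypothesis dg : forall i j x, is_derive x 'e_i (g j) (H i j x).
Hypothesis cH : forall i j, continuous (H i j).
Hypothesis trH : forall x, \sum_i H i i x = psi x.
Hypothesis dpsi : forall i x, is_derive x 'e_i psi (psi1 i x).
Hypothesis cpsi1 : forall i, continuous (psi1 i).
Hypothesis da : forall i x, is_derive x 'e_i a (a1 i x).
Hypothesis da1 : forall i x, is_derive x 'e_i (a1 i) (a2 i x).
Hypothesis db : forall i x, is_derive x 'e_i b (b1 i x).
Hypothesis db1 : forall i x, is_derive x 'e_i (b1 i) (b2 i x).
Hypothesis ca : continuous a.
Hypothesis ca1 : forall i, continuous (a1 i).
Hypothesis ca2 : forall i, continuous (a2 i).
Hypothesis cb : continuous b.
Hypothesis cb1 : forall i, continuous (b1 i).
Hypothesis cb2 : forall i, continuous (b2 i).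

Let Q x := \sum_j g j x ^+ 2.

Let cg j : continuous (g j).
Proof. exact: (partial_continuous (fun i x => dg i j x) (fun i => cH (i := i) (j := j))). Qed.

Let cw : continuous w.
Proof. exact: (partial_continuous dw cg). Qed.

(** Replace [Q] by the sum [Qh] of squared difference quotients of [w] with a small increment, and
    subtract [r * sqdist x0]. The new function is twice derivable along the axes and has an interior
    maximum near [x0]. The mean value theorem turns each quotient in its derivative tests into a
    value of [g], [H] or [psi1] at a nearby point; the right-hand sides come from the derivatives of
    the penalty. *)
Lemma touching_points x0 (r0 r : R) : 0 < r0 ->
  (forall x, ball x0 r0 x -> a x * Q x + b x <= a x0 * Q x0 + b x0) ->
  0 < r ->
  exists (x : V) (y : 'I_n -> 'I_n -> V) (z z' : 'I_n -> V),
  [/\ ball x0 r x /\ (forall i j, ball x0 r (y i j)),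
      (forall j, ball x0 r (z j)) /\ (forall j, ball x0 r (z' j)),
      (forall i, `|a x * (2 * \sum_j g j (z j) * H j i (y j i)) +
          (\sum_j g j (z j) ^+ 2) * a1 i x + b1 i x| <= 2 * r * r) &
      a x * (2 * (\sum_i \sum_j H j i (y j i) ^+ 2 + \sum_j g j (z j) * psi1 j (z' j)))
      + \sum_i 2 * a1 i x * (2 * \sum_j g j (z j) * H j i (y j i))
      + (\sum_j g j (z j) ^+ 2) * (\sum_i a2 i x) + \sum_i b2 i x <= 2 * r * n%:R].
Proof.
move=> r0_gt0 hmax r_gt0.
have [Ca [ra [Ca0 ra0 ha]]] := near_bounded x0 ca.
have [Cg [rg [Cg0 rg0 hg]]] := near_bounded_fin x0 cg.
have [CH [rH [CH0 rH0 hH]]] := near_bounded_fin x0 (fun i => cH (i := i) (j := i)).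
pose m := Num.min (Num.min r r0) (Num.min ra (Num.min rg rH)).
have m0 : 0 < m by rewrite !lt_min r_gt0 r0_gt0 ra0 rg0 rH0.
have mr : m <= r by rewrite /m !ge_min lexx.
have mr0 : m <= r0 by rewrite /m !ge_min lexx orbT.
have mra : m <= ra by rewrite /m !ge_min lexx !orbT.
have mrg : m <= rg by rewrite /m !ge_min lexx !orbT.
have mrH : m <= rH by rewrite /m !ge_min lexx !orbT.
(* A point is within [2 * rho] of [x0] and a shift adds at most [rho], which stays below [m]. *)
have [rho rhoE rho0] : exists2 rho, rho = m / 4 & 0 < rho by exists (m / 4); rewrite ?divr_gt0.
pose K := Ca * (n%:R * (2 * Cg * CH)) + 1.
have K0 : 0 < K by rewrite ltr_wpDl // !mulr_ge0 // ltW.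
(* Replacing [Q] by [Qh] costs at most [K * h] at each point; for two points this is at most half of
   the penalty [r * rho ^+ 2] on the sphere. *)
pose h := Num.min rho (r * rho ^+ 2 / (4 * K)).
have h0 : 0 < h by rewrite lt_min rho0 !(divr_gt0, mulr_gt0, exprn_gt0).
have hrho : h <= rho by rewrite /h ge_min lexx.
have hK : 4 * K * h <= r * rho ^+ 2.
  by rewrite mulrC -ler_pdivlMr ?mulr_gt0 // /h ge_min lexx orbT.
have inball x j t : sqdist x0 x <= rho ^+ 2 -> `|t| <= h ->
    ball x0 m (x + t *: 'e_j).
  move=> hx th.
  have : ball x0 (2 * rho) x.
    apply: sqdist_ball; first by rewrite mulr_gt0.
    by apply: (le_lt_trans hx); rewrite exprMn ltr_pMl ?exprn_gt0 //; lra.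
  move=> /rV_ballP[_ hb]; apply/rV_ballP; split=> // i; rewrite !mxE.
  have := hb i; have : `|t * ((0 == 0 :> 'I_1) && (i == j))%:R| <= rho.
    rewrite normrM (le_trans _ (le_trans th hrho)) // ler_piMr //.
    by case: (_ && _); rewrite ?normr1 ?normr0.
  rewrite opprD addrA => h1 h2.
  apply: le_lt_trans (ler_normB _ _) _.
  by apply: le_lt_trans (lerD (ltW h2) h1) _; rewrite rhoE; lra.
have inball0 x : sqdist x0 x <= rho ^+ 2 -> ball x0 m x.
  (* [inball] needs a direction [j]; for [n = 0] there is none and the ball condition is vacuous. *)
  move=> hx; have [j _|] := pickP (fun _ : 'I_n => true).
    by have := inball x j 0 hx; rewrite normr0 scale0r addr0; apply; exact: ltW.
  by move=> no; apply/rV_ballP; split=> // i; have := no i.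
pose D j x := h^-1 * (w (x + h *: 'e_j) - w x).
pose D1 i j x := h^-1 * (g i (x + h *: 'e_j) - g i x).
pose D2 i j x := h^-1 * (H i i (x + h *: 'e_j) - H i i x).
have dD i j x : is_derive x 'e_i (D j) (D1 i j x).
  exact: (pd_scale h^-1 (pd_sub (pd_shift (h *: 'e_j) (dw i) x) (dw i x))).
have dD1 i j x : is_derive x 'e_i (D1 i j) (D2 i j x).
  exact: (pd_scale h^-1 (pd_sub (pd_shift (h *: 'e_j) (dg i i) x) (dg i i x))).
pose Qh x := \sum_j D j x ^+ 2.
pose Q1 i x := \sum_j 2 * (D j x * D1 i j x).
pose Q2 i x := \sum_j 2 * (D j x * D2 i j x + D1 i j x * D1 i j x).
have dQh i x : is_derive x 'e_i Qh (Q1 i x).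
  apply: (is_derive_eq (pd_sum (fun j => pd_sqr (dD i j x)))).
  by apply: eq_bigr => j _; rewrite mulrA.
have dQ1 i x : is_derive x 'e_i (Q1 i) (Q2 i x).
  exact: (pd_sum (fun j => pd_scale 2 (pd_mul (dD i j x) (dD1 i j x)))).
pose G x := a x * Qh x + b x - r * sqdist x0 x.
pose G1 i x := a x * Q1 i x + Qh x * a1 i x + b1 i x - r * (2 * (x 0 i - x0 0 i)).
pose G2 i x := a x * Q2 i x + Q1 i x * a1 i x + (Qh x * a2 i x + a1 i x * Q1 i x)
   + b2 i x - r * 2.
have dG i x : is_derive x 'e_i G (G1 i x).
  exact: (pd_sub (pd_add (pd_mul (da i x) (dQh i x)) (db i x)) (pd_scale r (pd_sqdist x0 i x))).
have dG1 i x : is_derive x 'e_i (G1 i) (G2 i x).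
  have dx := pd_scale r (pd_scale 2 (pd_sub (pd_coord i i x) (pd_cst (x0 0 i) x 'e_i))).
  apply: (is_derive_eq (pd_sub (pd_add (pd_add (pd_mul (da i x) (dQ1 i x))
    (pd_mul (dQh i x) (da1 i x))) (db1 i x)) dx)).
  by rewrite eqxx subr0 mulr1.
have cshift (f : V -> R) (c : V) : continuous f -> continuous (fun x => f (x + c)).
  move=> cf x; apply: (@continuous_comp _ _ _ (fun x => x + c) f); last exact: cf.
  suff ct (y : V) : {for y, continuous (fun x : V => x + c)} by exact: ct.
  by apply: continuousD; [exact: (fun A h => h)|exact: cst_continuous].
have cG : continuous G.
  apply: cts_add; last by apply: cts_opp; apply: cts_mul; [exact: cts_cst|exact: continuous_sqdist].
  apply: cts_add => //; apply: cts_mul => //; apply: cts_sum => j; apply: cts_sqr.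
  apply: cts_mul; first exact: cts_cst.
  by apply: cts_add; [exact: cshift|exact: cts_opp].
have mvD j x : exists t, 0 <= t <= h /\ D j x = g j (x + t *: 'e_j).
  have [t [t0 th E]] := derive_mvt x (dw j) h0.
  exists t; split; first by rewrite !ltW.
  by rewrite /D E mulrC mulfK // gt_eqF.
have mvD1 i j x : exists t, 0 <= t <= h /\ D1 i j x = H j i (x + t *: 'e_j).
  have [t [t0 th E]] := derive_mvt x (dg j i) h0.
  exists t; split; first by rewrite !ltW.
  by rewrite /D1 E mulrC mulfK // gt_eqF.
have mvpsi j x : exists t, 0 <= t <= h /\ h^-1 * (psi (x + h *: 'e_j) - psi x) = psi1 j (x + t *: 'e_j).
  have [t [t0 th E]] := derive_mvt x (dpsi j) h0.
  exists t; split; first by rewrite !ltW.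
  by rewrite E mulrC mulfK // gt_eqF.
have hQ x : sqdist x0 x <= rho ^+ 2 -> `|a x * (Qh x - Q x)| <= K * h.
  move=> hx; rewrite normrM.
  apply: le_trans (_ : Ca * (\sum_(j < n) 2 * Cg * CH * h) <= _); last first.
    by rewrite sumr_const card_ord /K -mulr_natl; nra.
  apply: ler_pM => //; first by apply: ha; apply: le_ball mra _ (inball0 _ hx).
  rewrite /Qh /Q -sumrB; apply: le_trans (ler_norm_sum _ _ _) _.
  apply: ler_sum => j _; have [t [/andP[t0 th] ->]] := mvD j x.
  rewrite subr_sqr normrM.
  have tn : `|t| = t by rewrite ger0_norm.
  have bg s : `|s| <= h -> `|g j (x + s *: 'e_j)| <= Cg.
    by move=> sh; apply: hg; apply: le_ball mrg _ (inball _ _ _ hx sh).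
  have b1' : `|g j (x + t *: 'e_j) - g j x| <= CH * `|t|.
    apply: derive_bound (dg j j) _ => s hs.
    apply: hH; apply: le_ball mrH _ (inball _ _ _ hx _).
    by apply: le_trans hs _; rewrite tn.
  have g1 := bg t; rewrite tn in g1; have := bg 0.
  rewrite normr0 scale0r addr0 => /(_ (ltW h0)) g2.
  apply: le_trans (ler_pM _ _ b1' (le_trans (ler_normD _ _) (lerD (g1 th) g2))) _ => //.
  rewrite tn; have : t * (CH * Cg) <= h * (CH * Cg) by rewrite ler_wpM2r // mulr_ge0 // ltW.
  lra.
(* On the sphere the penalty outweighs the approximation error, so [G] attains its maximum over the
   ball inside. *)
have hbd x : sqdist x0 x = rho ^+ 2 -> G x < G x0.
  move=> hx; have := hQ x; rewrite hx lexx => /(_ isT); have := hQ x0.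
  rewrite sqdistxx sqr_ge0 => /(_ isT).
  rewrite !ler_norml => /andP[h1 _] /andP[_ h2].
  have h3 := hmax x (le_ball mr0 (inball0 x _)).
  rewrite /G hx sqdistxx.
  have : a x * Q x + b x <= a x0 * Q x0 + b x0 by apply: h3; rewrite hx.
  have : 0 < r * rho ^+ 2 by rewrite mulr_gt0 // exprn_gt0.
  nra.
have [c hc cmax] := sqdist_ball_max x0 cG (sqr_ge0 rho).
have hc' : sqdist x0 c < rho ^+ 2.
  rewrite lt_neqAle hc andbT; apply/eqP => E; have := hbd c E.
  by rewrite ltNge cmax // sqdistxx sqr_ge0.
have [s s0 hs] := sqdist_lt_nbhs hc'.
have first_second i : G1 i c = 0 /\ G2 i c <= 0.
  apply: (local_max_second_order s0 (dG i) (dG1 i c)) => y hy.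
  by apply: cmax; apply: ltW; exact: hs.
have [tz htz] := choice (fun j => mvD j c).
have [ty hty] := choice (fun p : 'I_n * 'I_n => mvD1 p.2 p.1 c).
have [tp htp] := choice (fun j => mvpsi j c).
exists c, (fun j i => c + ty (j, i) *: 'e_j), (fun j => c + tz j *: 'e_j),
  (fun j => c + tp j *: 'e_j).
have EQ : \sum_j g j (c + tz j *: 'e_j) ^+ 2 = Qh c.
  by apply: eq_bigr => j _; have [_ ->] := htz j.
have EQ1 i : 2 * \sum_j g j (c + tz j *: 'e_j) * H j i (c + ty (j, i) *: 'e_j) = Q1 i c.
  rewrite mulr_sumr; apply: eq_bigr => j _.
  by have [_ ->] := htz j; have [_ /= ->] := hty (j, i).
have inb j t : 0 <= t <= h -> ball x0 r (c + t *: 'e_j).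
  by move=> /andP[t0 th]; apply: le_ball mr _ (inball _ _ _ hc _); rewrite ger0_norm.
split.
- split; first by apply: le_ball mr _ (inball0 _ hc).
  by move=> i j; apply: inb; have [] := hty (i, j).
- by split=> j; apply: inb; [have [] := htz j|have [] := htp j].
- move=> i; rewrite EQ EQ1; have [E _] := first_second i.
  have -> : a c * Q1 i c + Qh c * a1 i c + b1 i c = r * (2 * (c 0 i - x0 0 i)).
    by apply/eqP; rewrite -subr_eq0; apply/eqP.
  have /rV_ballP[_ /(_ i)] := inball0 _ hc.
  rewrite !normrM (gtr0_norm r_gt0) ger0_norm // distrC => hi.
  have := ltW (lt_le_trans hi mr); nra.
- rewrite EQ; under [X in _ + X + _ + _]eq_bigr do rewrite EQ1.
  have : \sum_i G2 i c <= 0 by apply: sumr_le0 => i _; have [] := first_second i.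
  have -> : \sum_i G2 i c = a c * (\sum_i Q2 i c) + \sum_i 2 * a1 i c * Q1 i c +
     Qh c * \sum_i a2 i c + \sum_i b2 i c - 2 * r * n%:R.
    have -> : 2 * r * n%:R = \sum_(i < n) r * 2 by rewrite sumr_const card_ord -mulr_natr; ring.
    rewrite !mulr_sumr -!big_split /= -sumrB; apply: eq_bigr => i _.
    by rewrite /G2; ring.
  have -> : \sum_i Q2 i c = 2 * (\sum_i \sum_j H j i (c + ty (j, i) *: 'e_j) ^+ 2 +
      \sum_j g j (c + tz j *: 'e_j) * psi1 j (c + tp j *: 'e_j)).
    have -> : \sum_i Q2 i c = \sum_i \sum_j 2 * (D j c * D2 i j c) + \sum_i \sum_j 2 * (D1 i j c * D1 i j c).
      rewrite -big_split; apply: eq_bigr => i _; rewrite -big_split.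
      by apply: eq_bigr => j _ /=; ring.
    rewrite mulrDr addrC !mulr_sumr; congr (_ + _).
      apply: eq_bigr => i _; rewrite mulr_sumr; apply: eq_bigr => j _.
      by have [_ /= <-] := hty (j, i); rewrite expr2.
    (* Summing [D2 i j c] over [i] gives the difference quotient of the trace [psi], which the mean
       value theorem turns into [psi1 j]: no third derivative of [w] appears. *)
    rewrite exchange_big; apply: eq_bigr => j _ /=.
    have [_ <-] := htp j; have [_ <-] := htz j.
    by rewrite -!trH -sumrB !mulr_sumr.
  by rewrite subr_le0.
Qed.


(* The difference quotients deliver grad Q as 2 \sum_j g j * H j i, with the Hessian
   transposed, so its symmetry is not needed. *)
Lemma local_max_bochner x0 (r0 : R) : 0 < r0 ->
  (forall x, ball x0 r0 x -> a x * Q x + b x <= a x0 * Q x0 + b x0) ->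
  (forall i, a x0 * (2 * \sum_j g j x0 * H j i x0) + Q x0 * a1 i x0 + b1 i x0 = 0) /\
  a x0 * (2 * (\sum_i \sum_j H j i x0 ^+ 2 + \sum_j g j x0 * psi1 j x0))
    + \sum_i 2 * a1 i x0 * (2 * \sum_j g j x0 * H j i x0)
    + Q x0 * (\sum_i a2 i x0) + \sum_i b2 i x0 <= 0.
Proof.
(* Apply [touching_points] with radius [u k]: all its points converge to [x0], both error terms
   vanish, and continuity gives the limit relations. *)
move=> r00 hmax; pose u (k : nat) : R := k.+1%:R^-1.
have u0 k : 0 < u k by rewrite invr_gt0.
have cu : u k @[k --> \oo] --> (0 : R) by exact: cvg_harmonic.
have [x hx] := choice (fun k => touching_points r00 hmax (u0 k)).
have [y hy] := choice hx; have [z hz] := choice hy; have [z' hz'] := choice hz.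
have cvx (p : nat -> V) (f : V -> R) : (forall k, ball x0 (u k) (p k)) ->
    continuous f -> f (p k) @[k --> \oo] --> f x0.
  move=> hp cf; apply: (@cvg_comp _ _ _ p f \oo (nbhs x0) (nbhs (f x0))); last exact: cf.
  apply/cvg_ballP => eps eps0.
  have : \forall k \near \oo, u k < eps by exact: (cvgr_lt _ cu).
  by apply: filterS => k /ltW uk; exact: le_ball uk _ (hp k).
have cvsum (F : 'I_n -> nat -> R) (l : 'I_n -> R) :
    (forall i, F i k @[k --> \oo] --> l i) -> \sum_i F i k @[k --> \oo] --> \sum_i l i.
  by move=> h; apply: cvg_big => //; exact: add_continuous.
have cvmul (F G : nat -> R) (l m : R) : F k @[k --> \oo] --> l -> G k @[k --> \oo] --> m ->
    F k * G k @[k --> \oo] --> l * m by exact: cvgM.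
have cvadd (F G : nat -> R) (l m : R) : F k @[k --> \oo] --> l -> G k @[k --> \oo] --> m ->
    F k + G k @[k --> \oo] --> l + m by exact: cvgD.
have cvcst (c : R) : c @[_ --> (\oo : set_system nat)] --> c by exact: cvg_cst.
have cvsqr (F : nat -> R) (l : R) : F k @[k --> \oo] --> l ->
    F k ^+ 2 @[k --> \oo] --> l ^+ 2.
  by move=> h; rewrite expr2; under eq_cvg do rewrite expr2; exact: (cvmul).
have bx k : ball x0 (u k) (x k) by have [[]] := hz' k.
have by' i j k : ball x0 (u k) (y k i j) by have [[]] := hz' k.
have bz j k : ball x0 (u k) (z k j) by have [_ []] := hz' k.
have bz' j k : ball x0 (u k) (z' k j) by have [_ []] := hz' k.
have cQ : \sum_j g j (z k j) ^+ 2 @[k --> \oo] --> Q x0.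
  by apply: (cvsum) => j; apply: (cvsqr); apply: (cvx).
have cgH i : 2 * \sum_j g j (z k j) * H j i (y k j i) @[k --> \oo]
    --> 2 * \sum_j g j x0 * H j i x0.
  by apply: (cvmul) => //; apply: (cvsum) => j; apply: (cvmul); apply: (cvx).
split.
  move=> i; apply/eqP; rewrite -normr_le0.
  apply: (@ler_cvg_to nat \oo _ R (fun k => `|a (x k) * (2 * \sum_j g j (z k j) * H j i (y k j i)) +
          (\sum_j g j (z k j) ^+ 2) * a1 i (x k) + b1 i (x k)|) (fun k => 2 * u k * u k)).
  - apply: cvg_norm; apply: (cvadd); last exact: (cvx).
    by apply: (cvadd); apply: (cvmul) => //; exact: (cvx).
  - rewrite [X in _ --> X](_ : _ = 2 * 0 * 0); last by rewrite mulr0.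
    by apply: (cvmul) => //; apply: (cvmul).
  - by apply: nearW => k; have [_ _ h _] := hz' k.
apply: (@ler_cvg_to nat \oo _ R (fun k =>
  a (x k) * (2 * (\sum_i \sum_j H j i (y k j i) ^+ 2 + \sum_j g j (z k j) * psi1 j (z' k j)))
      + \sum_i 2 * a1 i (x k) * (2 * \sum_j g j (z k j) * H j i (y k j i))
      + (\sum_j g j (z k j) ^+ 2) * (\sum_i a2 i (x k)) + \sum_i b2 i (x k))
  (fun k => 2 * u k * n%:R)).
- apply: (cvadd); last by apply: (cvsum) => i; exact: (cvx).
  apply: (cvadd); last by apply: (cvmul) => //; apply: (cvsum) => i; exact: (cvx).
  apply: (cvadd).
    apply: (cvmul); first exact: (cvx).
    apply: (cvmul) => //; apply: (cvadd); apply: (cvsum) => i.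
      by apply: (cvsum) => j; apply: (cvsqr); exact: (cvx).
    by apply: (cvmul); exact: (cvx).
  apply: (cvsum) => i; apply: (cvmul) => //; apply: (cvmul) => //; exact: (cvx).
- rewrite [X in _ --> X](_ : _ = 2 * 0 * n%:R); last by rewrite mulr0 mul0r.
  by apply: (cvmul) => //; apply: (cvmul).
- by apply: nearW => k; have [_ _ _ h] := hz' k.
Qed.

End touching.

(** * The quadratic form in [Q] and [h], and the scalar estimate at a maximum *)

Section scalar.
Context {R : realType}.
Implicit Types (m s tau b Q h : R).

Definition coefQ2 m s : R := (1 + s / 2) * ((1 + s / 2) / (m - 1) - s / 2).
Definition coefQh m s tau b : R :=
  s / 2 + (2 + s) / (m - 1) + tau * (1 - (2 + s) / (m - 1)) - b * (1 - tau).
Definition coefh2 m tau : R := (1 - m * tau) / m.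

(** The first bracket, together with a term [2 gam q], bounds the squared norm of the Hessian from
    below. [alp] maximises this bound for the given [gam], and [gam] is the optimal multiplier for
    [tau = 1 / m] under the relation [2 q = (s Q - 2 tau h) Q] that holds at a critical point
    without cutoff. *)
Lemma bochner_form m s tau b Q h (gam := (m * s / 2 + 1) / (m - 1))
    (alp := - ((1 + s / 2) * Q / (m - 1) + h / m)) : m != 0 -> m - 1 != 0 ->
  (2 * alp * (- Q - h) - m * alp ^+ 2 - 2 * alp * gam * Q - gam ^+ 2 * Q ^+ 2)
  + (gam - 1 - s) * (s * Q - 2 * tau * h) * Q - (1 - tau) * b * h * Q
  + Q * (s ^+ 2 * Q + s * Q + s * h) / 2
  - tau * s * h * Q - tau * h * Q - tau * h ^+ 2
  = coefQ2 m s * Q ^+ 2 + coefQh m s tau b * (Q * h) + coefh2 m tau * h ^+ 2.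
Proof.
by move=> m0 m1; rewrite /gam /alp /coefQ2 /coefQh /coefh2; field; rewrite m0 m1.
Qed.

(** At the maximum point [eta] is the cutoff, [P] is [N] divided by the weight, [y2] the squared
    gradient of the cutoff, [yg] its product with grad w, [m2] the squared norm of Hess w; [q] and
    [my] pair Hess w grad w with grad w and with the gradient of the cutoff. The form dominates a
    multiple of [(Q + h) ^+ 2], while the cutoff errors carry only one factor [Q + P], itself
    bounded by [Q + h] up to a constant. [K] is fixed before [B]. *)
Lemma max_point_estimate m s tau b C1 :
  1 < m -> tau <= 1 -> 0 < C1 ->
  0 < coefQ2 m s -> 0 <= coefQh m s tau b -> 0 < coefh2 m tau ->
  exists2 K : R, 0 < K & forall (B Q h h1 P eta yg y2 q my m2 : R),
    0 < B -> 0 <= Q -> 0 < h -> h1 <= b * h -> P <= C1 * h ->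
    0 < eta <= 1 -> 0 <= y2 <= 4 / B -> yg ^+ 2 <= y2 * Q ->
    (forall al ga : R, 2 * al * (- Q - h) + 2 * ga * q - m * al ^+ 2
        - 2 * al * ga * Q - ga ^+ 2 * Q ^+ 2 <= m2) ->
    2 * eta * q = eta * (s * Q - 2 * tau * h) * Q - 2 * (Q + P) * yg ->
    2 * eta * my = eta * (s * Q - 2 * tau * h) * yg - 2 * (Q + P) * y2 ->
    2 * eta ^+ 2 * (m2 - 2 * q - h1 * Q) - 4 * s * eta ^+ 2 * q + 8 * eta * my
    + Q * (eta ^+ 2 * (s ^+ 2 * Q + s * (Q + h)) - 4 * s * eta * yg
           + (2 * y2 + 2 * eta * (- (2 * m / B))))
    + eta ^+ 2 * (2 * tau * (h1 - s * h) * Q - 2 * tau * h * (Q + h))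
    + 8 * tau * eta * h * yg + P * (2 * y2 + 2 * eta * (- (2 * m / B))) <= 0 ->
    eta ^+ 2 * (Q + P) <= K / B.
Proof.
move=> m1 tau1 C1_gt0 A0 B0 D0.
have m0 : m != 0 by rewrite gt_eqF //; lra.
have m10 : m - 1 != 0 by rewrite gt_eqF //; lra.
pose gam := (m * s / 2 + 1) / (m - 1).
(* The factor 2 serves [2 (Q^2 + h^2) >= (Q + h)^2]. *)
have [c [c0 cA cD]] : exists c, [/\ 0 < c, 2 * c <= coefQ2 m s & 2 * c <= coefh2 m tau].
  exists (Num.min (coefQ2 m s) (coefh2 m tau) / 2).
  have hm : 0 < Num.min (coefQ2 m s) (coefh2 m tau) by rewrite lt_min A0.
  have h1 : Num.min (coefQ2 m s) (coefh2 m tau) <= coefQ2 m s by rewrite ge_min lexx.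
  have h2 : Num.min (coefQ2 m s) (coefh2 m tau) <= coefh2 m tau by rewrite ge_min lexx orbT.
  by split; lra.
pose C2 := 12 + 2 * m; pose C3 := 2 * `|gam - 1 - s|; pose D1 := 1 + C1.
have C30 : 0 <= C3 by rewrite mulr_ge0.
have C20 : 0 < C2 by rewrite /C2; lra.
have D10 : 0 < D1 by rewrite /D1; lra.
pose K := D1 * (2 / c * (D1 * C2 + 2 * (D1 * C3) ^+ 2 / c)).
have K0 : 0 < K.
  rewrite mulr_gt0 // mulr_gt0 ?divr_gt0 // ltr_pwDl ?mulr_gt0 //.
  by rewrite mulr_ge0 ?invr_ge0 ?(ltW c0) // mulr_ge0 // sqr_ge0.
exists K => // B Q h h1 P eta yg y2 q my m2 Bp Q0 h0 h1h PC /andP[e0 e1] /andP[y20 y2B] ygQ hm2 Eq Emy main.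
set J := Q + P in Eq Emy *.
have JE : P = J - Q by rewrite /J; ring.
have [J0|J0] := leP J 0.
  by apply: le_trans (_ : 0 <= _); [rewrite mulr_ge0_le0 // sqr_ge0|rewrite divr_ge0 // ltW].
pose alp := - ((1 + s / 2) * Q / (m - 1) + h / m).
have hm2' := hm2 alp gam.
have form := bochner_form s tau b Q h m0 m10; rewrite -/gam -/alp in form.
pose LB := 2 * alp * (- Q - h) - m * alp ^+ 2 - 2 * alp * gam * Q - gam ^+ 2 * Q ^+ 2.
have hm3 : eta ^+ 2 * (LB + 2 * gam * q) <= eta ^+ 2 * m2.
  by rewrite ler_wpM2l ?sqr_ge0 // /LB; apply: le_trans hm2'; lra.
have Eq2 : 2 * eta ^+ 2 * q = eta ^+ 2 * (s * Q - 2 * tau * h) * Q - 2 * eta * J * yg.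
  have -> : 2 * eta ^+ 2 * q = eta * (2 * eta * q) by ring.
  by rewrite Eq; ring.
have Eq3 : (gam - 1 - s) * (2 * eta ^+ 2 * q) = (gam - 1 - s) *
   (eta ^+ 2 * (s * Q - 2 * tau * h) * Q - 2 * eta * J * yg) by rewrite Eq2.
have h1Q : eta ^+ 2 * ((1 - tau) * (h1 * Q)) <= eta ^+ 2 * ((1 - tau) * (b * h * Q)).
  by rewrite ler_wpM2l ?sqr_ge0 // ler_wpM2l ?subr_ge0 // ler_wpM2r.
(* This is half of [main]. After substituting for [my], the [yg] terms without a factor [J] cancel,
   so every cutoff error is a multiple of [J]. *)
have key : eta ^+ 2 * (coefQ2 m s * Q ^+ 2 + coefQh m s tau b * (Q * h) + coefh2 m tau * h ^+ 2)
   <= J * (3 * y2 + eta * (2 * m / B) + 2 * (gam - 1 - s) * (eta * yg)).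
  rewrite -form -/LB; rewrite JE in main; clear -hm3 Eq3 h1Q Emy main.
  move: (2 * m / B) main => S main; clearbody LB gam alp; lra.
clear main hm2 hm2' form hm3 Eq Eq2 Eq3 Emy h1Q.
set Z := Q + h.
have Z0 : 0 < Z by rewrite /Z; lra.
have JZ : J <= D1 * Z.
  have C1Q : 0 <= C1 * Q by rewrite mulr_ge0 // ltW.
  by rewrite /D1 /Z JE in PC *; lra.
have low : eta ^+ 2 * (c * Z ^+ 2) <= eta ^+ 2 *
    (coefQ2 m s * Q ^+ 2 + coefQh m s tau b * (Q * h) + coefh2 m tau * h ^+ 2).
  rewrite ler_wpM2l ?sqr_ge0 //.
  have p1 : 2 * c * Q ^+ 2 <= coefQ2 m s * Q ^+ 2 by rewrite ler_wpM2r ?sqr_ge0.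
  have p2 : 2 * c * h ^+ 2 <= coefh2 m tau * h ^+ 2 by rewrite ler_wpM2r ?sqr_ge0.
  have p3 : 0 <= coefQh m s tau b * (Q * h) by rewrite !mulr_ge0 // ltW.
  have p4 : 0 <= c * (Q - h) ^+ 2 by rewrite mulr_ge0 ?sqr_ge0 // ltW.
  by rewrite /Z; lra.
set X := eta * yg in key.
have hX : 2 * (gam - 1 - s) * X <= C3 * `|X|.
  apply: le_trans (ler_norm _) _.
  by rewrite /C3 !normrM (ger0_norm (_ : 0 <= 2)).
have up : J * (3 * y2 + eta * (2 * m / B) + 2 * (gam - 1 - s) * X) <=
    D1 * Z * (C2 / B + C3 * `|X|).
  have Bi : 0 < B^-1 by rewrite invr_gt0.
  have mB : eta * (2 * m / B) <= 2 * m / B.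
    by rewrite ler_piMl // mulr_ge0 ?(ltW Bi) //; lra.
  have C2B : C2 / B = 3 * (4 / B) + 2 * m / B by rewrite /C2; lra.
  apply: le_trans (_ : J * (C2 / B + C3 * `|X|) <= _).
    by rewrite ler_wpM2l ?(ltW J0) //; lra.
  by rewrite ler_wpM2r // addr_ge0 ?mulr_ge0 // ltW.
have step : eta ^+ 2 * (c * Z) <= D1 * (C2 / B + C3 * `|X|).
  rewrite -(ler_pM2r Z0).
  apply: le_trans (_ : eta ^+ 2 * (c * Z ^+ 2) <= _); first by rewrite le_eqVlt; apply/orP; left; apply/eqP; ring.
  by apply: le_trans low _; apply: le_trans key _; apply: le_trans up _; lra.
(* Young's inequality: the first summand is absorbed by half of the left side of [step], the second
   is of order [1 / B]. *)
have amgm : D1 * C3 * `|X| <= c / 2 * (eta ^+ 2 * Z) + 2 * (D1 * C3) ^+ 2 / c / B.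
  have X2 : `|X| ^+ 2 <= eta ^+ 2 * (4 / B * Z).
    rewrite real_normK ?num_real // /X exprMn ler_wpM2l ?sqr_ge0 //.
    apply: le_trans ygQ _; apply: ler_pM => //; rewrite /Z; lra.
  set k := D1 * C3.
  have sq0 : 0 <= (k * 4 / B / c - `|X|) ^+ 2 by exact: sqr_ge0.
  have cB : 0 < c * B / 8 by rewrite divr_gt0 // mulr_gt0.
  have : 0 <= c * B / 8 * (k * 4 / B / c - `|X|) ^+ 2 by rewrite mulr_ge0 // ltW.
  have -> : c * B / 8 * (k * 4 / B / c - `|X|) ^+ 2 =
     2 * k ^+ 2 / c / B - k * `|X| + c * B / 8 * `|X| ^+ 2.
    by field; rewrite !gt_eqF.
  have : c * B / 8 * `|X| ^+ 2 <= c * B / 8 * (eta ^+ 2 * (4 / B * Z)).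
    by rewrite ler_wpM2l // ltW.
  have -> : c * B / 8 * (eta ^+ 2 * (4 / B * Z)) = c / 2 * (eta ^+ 2 * Z).
    by field; rewrite gt_eqF.
  lra.
have fin : eta ^+ 2 * Z <= 2 / c * (D1 * C2 + 2 * (D1 * C3) ^+ 2 / c) / B.
  have ci : 0 < c / 2 by rewrite divr_gt0.
  rewrite -(ler_pM2l ci).
  have -> : c / 2 * (2 / c * (D1 * C2 + 2 * (D1 * C3) ^+ 2 / c) / B) =
     D1 * (C2 / B) + 2 * (D1 * C3) ^+ 2 / c / B.
    by field; rewrite !gt_eqF.
  lra.
apply: le_trans (_ : eta ^+ 2 * (D1 * Z) <= _); first by rewrite ler_wpM2l ?sqr_ge0.
rewrite (_ : K / B = D1 * (2 / c * (D1 * C2 + 2 * (D1 * C3) ^+ 2 / c) / B)); last exact: (esym (mulrA _ _ _)).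
by rewrite mulrCA ler_pM2l.
Qed.

End scalar.

(** * Antiderivatives on the whole real line *)

Lemma continuous_antiderivative (R : realType) (phi : R -> R) (s0 : R) :
  continuous phi ->
  exists2 F : R -> R, (forall s : R, is_derive s (1 : R) F (phi s)) & F s0 = 0.
Proof.
move=> cphi.
pose mu := @lebesgue_measure R.
have intphi (a c : R) : mu.-integrable `[a, c] (EFin \o phi).
  apply: continuous_compact_integrable; first exact: segment_compact.
  exact: continuous_subspaceT.
pose I (k x : R) : R := (\int[mu]_(t in `[k, x]) phi t)%R.
have dI (k x : R) : k < x -> is_derive x (1 : R) (I k) (phi x).
  move=> kx; have [|d1 d2] := @continuous_FTC1_closed R phi k x (x + 1) _ (intphi _ _) kx (cphi x).
    by rewrite ltrDl.
  by move: d2; rewrite derive1E => d2; exact: DeriveDef d1 d2.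
(* The library's FTC only differentiates to the right of the base point, hence
   a base point that moves with s. *)
have Idiff (k x y : R) : k < x -> k < y -> forall k', k' < x -> k' < y ->
    I k y - I k x = I k' y - I k' x.
  wlog xy : x y / x <= y.
    move=> H kx ky k' k'x k'y; have [xy|/ltW yx] := leP x y; first exact: H.
    by have := H y x yx ky kx k' k'y k'x; lra.
  move=> kx ky k' k'x k'y.
  have cI (k1 : R) : k1 < x -> {within `[x, y], continuous (I k1)}.
    move=> k1x; apply: continuous_in_subspaceT => t; rewrite inE /= in_itv /= => /andP[xt _].
    apply: differentiable_continuous; apply/derivable1_diffP.
    by have [] := dI k1 t (lt_le_trans k1x xt).
  have [||c _ E] := @MVT_segment R (fun t => I k t - I k' t) (fun=> 0) x y xy.
  - move=> t; rewrite in_itv /= => /andP[xt _].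
    by apply: (is_derive_eq (pd_sub (dI k t (lt_trans kx xt)) (dI k' t (lt_trans k'x xt)))); rewrite subrr.
  - by move=> t; apply: cvgB; [exact: (cI k kx t)|exact: (cI k' k'x t)].
  - by move: E; rewrite mul0r; lra.
pose b (s : R) := - (`|s| + `|s0|) - 1.
pose F s := I (b s) s - I (b s) s0.
have bs s : b s < s /\ b s < s0.
  have := ler_norm (- s); have := ler_norm (- s0); rewrite !normrN /b.
  by have := normr_ge0 s; have := normr_ge0 s0; lra.
exists F; last by rewrite /F subrr.
move=> s; pose k := b s - 1.
have [ks ks0] : k < s /\ k < s0 by have := bs s; rewrite /k; lra.
(* Increments of [I] do not depend on the base point, so near [s] the moving one can be frozen at
   [k]. *)
have nb : \forall t \near s, I k t - I k s0 = F t.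
  near=> t.
  have kt : k < t by near: t; exact: lt_nbhsr.
  by have [h1 h2] := bs t; rewrite /F; exact: Idiff.
apply: (near_eq_is_derive nb).
by apply: (is_derive_eq (pd_sub (dI k s ks) (pd_cst _ _ _))); rewrite subr0.
Unshelve. all: by end_near. Qed.

(** * A matrix inequality, and localisation by a cutoff *)

Section cutoff.
Context {R : realType} {n : nat}.
Local Notation V := 'rV[R]_n.

(** Expand the nonnegative squared norm of [M - al Id - ga v v^T]. The case [ga = 0] is the usual
    trace inequality; the rank-one correction exploits what the critical-point equation says about
    [M] along the gradient. *)
Lemma matrix_sqr_lower (M : 'I_n -> 'I_n -> R) (v : 'I_n -> R) (al ga : R) :
  2 * al * (\sum_i M i i) + 2 * ga * (\sum_i v i * \sum_j v j * M j i)
    - n%:R * al ^+ 2 - 2 * al * ga * (\sum_i v i ^+ 2)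
    - ga ^+ 2 * (\sum_i v i ^+ 2) ^+ 2 <= \sum_i \sum_j M j i ^+ 2.
Proof.
rewrite -subr_ge0.
have delta (F : 'I_n -> R) i : \sum_j (i == j)%:R * F j = F i.
  rewrite (bigD1 i) //= eqxx mul1r big1 ?addr0 // => j ji.
  by rewrite eq_sym (negbTE ji) mul0r.
suff -> : \sum_i \sum_j M j i ^+ 2 - (2 * al * (\sum_i M i i)
    + 2 * ga * (\sum_i v i * \sum_j v j * M j i)
    - n%:R * al ^+ 2 - 2 * al * ga * (\sum_i v i ^+ 2)
    - ga ^+ 2 * (\sum_i v i ^+ 2) ^+ 2) =
  \sum_i \sum_j (M j i - al * (i == j)%:R - ga * (v i * v j)) ^+ 2.
  by apply: sumr_ge0 => i _; apply: sumr_ge0 => j _; exact: sqr_ge0.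
have E i : \sum_j (M j i - al * (i == j)%:R - ga * (v i * v j)) ^+ 2 =
   \sum_j M j i ^+ 2 - 2 * al * M i i - 2 * ga * (v i * \sum_j v j * M j i)
   + al ^+ 2 + 2 * al * ga * v i ^+ 2 + ga ^+ 2 * (v i ^+ 2 * \sum_j v j ^+ 2).
  have -> : M i i = \sum_j (i == j)%:R * M j i by rewrite delta.
  have -> : al ^+ 2 = \sum_j (i == j)%:R * al ^+ 2 by rewrite (delta (fun=> _)).
  rewrite [v i ^+ 2 in X in _ + X + _](_ : _ = \sum_j (i == j)%:R * (v i * v j)); last first.
    by rewrite (delta (fun j => v i * v j)) expr2.
  rewrite !mulr_sumr -!sumrN -!big_split /=; apply: eq_bigr => j _.
  by case: (i == j); rewrite /= ?mulr1n ?mulr0n; ring.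
under [RHS]eq_bigr do rewrite E.
rewrite !big_split /= !sumrN -!mulr_sumr -mulr_suml sumr_const card_ord.
by rewrite -mulr_natl; ring.
Qed.

(** [B] is the square of the radius, so derivative errors are of order [1 / B]. *)
Definition cutoff (B : R) (x : V) : R := 1 - B^-1 * sqdist 0 x.

Definition cutoff1 (B : R) (i : 'I_n) (x : V) : R := - (2 * B^-1 * x 0 i).

Lemma pd_cutoff B i x : is_derive x 'e_i (cutoff B) (cutoff1 B i x).
Proof.
apply: (is_derive_eq (pd_sub (pd_cst 1 x 'e_i) (pd_scale B^-1 (pd_sqdist 0 i x)))).
by rewrite mxE /cutoff1; ring.
Qed.

Lemma pd_cutoff1 B i x : is_derive x 'e_i (cutoff1 B i) (- (2 * B^-1)).
Proof.
apply: (is_derive_eq (pd_opp (pd_scale (2 * B^-1) (pd_coord i i x)))).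
by rewrite eqxx mulr1.
Qed.

Lemma cts_coord i : continuous (fun x : V => x 0 i).
Proof. exact: coord_continuous. Qed.

Lemma cts_cutoff B : continuous (cutoff B).
Proof.
apply: cts_add; first exact: cts_cst; apply: cts_opp.
by apply: cts_mul; [exact: cts_cst|exact: continuous_sqdist].
Qed.

Lemma cts_cutoff1 B i : continuous (cutoff1 B i).
Proof.
by apply: cts_opp; apply: cts_mul; [exact: cts_cst|exact: cts_coord].
Qed.

Variables (w : V -> R) (g : 'I_n -> V -> R) (H : 'I_n -> 'I_n -> V -> R).
Hypothesis dw : forall i x, is_derive x 'e_i w (g i x).
Hypothesis dg : forall i j x, is_derive x 'e_i (g j) (H i j x).
Hypothesis cH : forall i j, continuous (H i j).

Let cg j : continuous (g j).
Proof. exact: (partial_continuous (fun i x => dg i j x) (fun i => cH (i := i) (j := j))). Qed.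

Let cw : continuous w.
Proof. exact: (partial_continuous dw cg). Qed.

Section composite.
Variables (B : R) (phi phi1 phi2 : R -> R).
Hypothesis dphi : forall s : R, is_derive s (1 : R) phi (phi1 s).
Hypothesis dphi1 : forall s : R, is_derive s (1 : R) phi1 (phi2 s).
Hypothesis cphi2 : continuous phi2.

(** Serves for both coefficients of the localised Bernstein function [a * Q + b]: [phi] is the
    weight [exp (- s t)] in [a] and [N] in [b]. *)
Definition loc x : R := cutoff B x ^+ 2 * phi (w x).

Definition loc1 i x : R :=
  cutoff B x ^+ 2 * (phi1 (w x) * g i x) + phi (w x) * (2 * cutoff B x * cutoff1 B i x).

Definition loc2 i x : R :=
  cutoff B x ^+ 2 * (phi1 (w x) * H i i x + phi2 (w x) * g i x ^+ 2)
  + 4 * cutoff B x * cutoff1 B i x * (phi1 (w x) * g i x)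
  + phi (w x) * (2 * (cutoff B x * - (2 * B^-1) + cutoff1 B i x ^+ 2)).

Lemma pd_loc i x : is_derive x 'e_i loc (loc1 i x).
Proof.
exact: (pd_mul (pd_sqr (pd_cutoff B i x)) (is_derive_comp (dphi (w x)) (dw i x))).
Qed.

Lemma pd_loc1 i x : is_derive x 'e_i (loc1 i) (loc2 i x).
Proof.
have dp := is_derive_comp (dphi (w x)) (dw i x).
have dp1 := is_derive_comp (dphi1 (w x)) (dw i x).
have dc := pd_cutoff B i x; have dc1 := pd_cutoff1 B i x.
apply: (is_derive_eq (pd_add (pd_mul (pd_sqr dc) (pd_mul dp1 (dg i i x)))
  (pd_mul dp (pd_mul (pd_scale 2 dc) dc1)))).
by rewrite /loc2; ring.
Qed.

Let cphi1w : continuous (fun x => phi1 (w x)).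
Proof. by apply: cts_comp => //; exact: is_derive_continuous dphi1. Qed.

Lemma cts_loc : continuous loc.
Proof.
apply: cts_mul; first by apply: cts_sqr; exact: cts_cutoff.
by apply: cts_comp => //; exact: is_derive_continuous dphi.
Qed.

Lemma cts_loc1 i : continuous (loc1 i).
Proof.
apply: cts_add; apply: cts_mul.
- by apply: cts_sqr; exact: cts_cutoff.
- by apply: cts_mul => //; exact: cg.
- by apply: cts_comp => //; exact: is_derive_continuous dphi.
- apply: cts_mul; last exact: cts_cutoff1.
  by apply: cts_mul; [exact: cts_cst|exact: cts_cutoff].
Qed.

Lemma cts_loc2 i : continuous (loc2 i).
Proof.
have cc := @cts_cutoff B; have cc1 := @cts_cutoff1 B i.
apply: cts_add; first apply: cts_add.
- apply: cts_mul; first exact: cts_sqr.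
  apply: cts_add; first by apply: cts_mul => //; exact: cH.
  by apply: cts_mul; [exact: cts_comp|apply: cts_sqr; exact: cg].
- apply: cts_mul; last by apply: cts_mul => //; exact: cg.
  by apply: cts_mul => //; apply: cts_mul => //; exact: cts_cst.
- apply: cts_mul; first by apply: cts_comp => //; exact: is_derive_continuous dphi.
  apply: cts_mul; first exact: cts_cst.
  apply: cts_add; last exact: cts_sqr.
  by apply: cts_mul => //; exact: cts_cst.
Qed.

Lemma sum_loc2 x : \sum_i loc2 i x =
  cutoff B x ^+ 2 * (phi1 (w x) * (\sum_i H i i x) + phi2 (w x) * \sum_i g i x ^+ 2)
  + 4 * cutoff B x * (phi1 (w x) * \sum_i cutoff1 B i x * g i x)
  + phi (w x) * (2 * (\sum_i cutoff1 B i x ^+ 2) + 2 * cutoff B x * - (2 * n%:R / B)).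
Proof.
have -> : 2 * n%:R / B = \sum_(i < n) 2 * B^-1.
  by rewrite sumr_const card_ord -mulr_natl; ring.
rewrite -sumrN !mulr_sumr -!big_split /= !mulr_sumr -!big_split /=.
by apply: eq_bigr => i _; rewrite /loc2; ring.
Qed.

End composite.

End cutoff.

(** * The Bernstein gradient estimate *)

Lemma first_order_scalar (R : realFieldType) (E eta u Q s g tau h P y : R) :
  E != 0 -> eta != 0 ->
  eta ^+ 2 * E * (2 * u) + Q * (eta ^+ 2 * (- s * E * g) + E * (2 * eta * y))
   + (eta ^+ 2 * (2 * tau * (E * h) * g) + E * P * (2 * eta * y)) = 0 ->
  2 * eta * u = eta * (s * Q - 2 * tau * h) * g - 2 * (Q + P) * y.
Proof.
move=> E0 eta0 h0; have Ee : E * eta != 0 by rewrite mulf_neq0.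
by apply: (mulfI Ee); apply/eqP; rewrite -subr_eq0 -[X in _ == X]h0; apply/eqP; ring.
Qed.

(** The weight [E] factors out of the whole second-order condition, because [N' = 2 tau E h] carries
    it and [N] is written as [E P]. *)
Lemma second_order_scalar (R : realFieldType)
    (E eta m2 q h1 Q s my tau h P yg y2 S cross : R) :
  cross = E * (- 4 * s * eta ^+ 2 * q + 8 * eta * my) ->
  eta ^+ 2 * E * (2 * (m2 + (- 2 * q - h1 * Q))) + cross
  + Q * (eta ^+ 2 * (- s * E * (- Q - h) + s ^+ 2 * E * Q)
         + 4 * eta * (- s * E * yg) + E * (2 * y2 + 2 * eta * - S))
  + (eta ^+ 2 * (2 * tau * (E * h) * (- Q - h) + 2 * tau * (E * h1 - s * E * h) * Q)
     + 4 * eta * (2 * tau * (E * h) * yg) + E * P * (2 * y2 + 2 * eta * - S)) =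
  E * (2 * eta ^+ 2 * (m2 - 2 * q - h1 * Q) - 4 * s * eta ^+ 2 * q + 8 * eta * my
    + Q * (eta ^+ 2 * (s ^+ 2 * Q + s * (Q + h)) - 4 * s * eta * yg
           + (2 * y2 + 2 * eta * (- S)))
    + eta ^+ 2 * (2 * tau * (h1 - s * h) * Q - 2 * tau * h * (Q + h))
    + 8 * tau * eta * h * yg + P * (2 * y2 + 2 * eta * (- S))).
Proof. by move=> ->; ring. Qed.

Section estimate.
Context {R : realType} {n : nat}.
Local Notation V := 'rV[R]_n.

Lemma sum_cauchy_schwarz (u v : 'I_n -> R) :
  (\sum_i u i * v i) ^+ 2 <= (\sum_i u i ^+ 2) * (\sum_i v i ^+ 2).
Proof.
set a := \sum_i u i ^+ 2; set b := \sum_i v i ^+ 2; set c := \sum_i u i * v i.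
have a0 : 0 <= a by apply: sumr_ge0 => i _; exact: sqr_ge0.
have h t : 0 <= a * t ^+ 2 - 2 * c * t + b.
  have -> : a * t ^+ 2 - 2 * c * t + b = \sum_i (u i * t - v i) ^+ 2.
    rewrite mulr_suml mulr_sumr mulr_suml -sumrN -!big_split /=.
    by apply: eq_bigr => i _; ring.
  by apply: sumr_ge0 => i _; exact: sqr_ge0.
have [a1|] := ltP 0 a.
  have := h (c / a); rewrite (_ : _ + b = b - c ^+ 2 / a); last first.
    by field; rewrite gt_eqF.
  by rewrite subr_ge0 ler_pdivrMr // mulrC.
move=> a2; have {a0 a2} a0 : a = 0 by lra.
have [-> |c0] := eqVneq c 0; first by rewrite a0 mul0r expr0n.
(* With [a = 0] the polynomial is affine in [t], and this [t] gives it the value [-1]. *)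
have := h ((b + 1) / (2 * c)); rewrite a0 mul0r add0r.
rewrite (_ : _ + b = -1); last by field.
by lra.
Qed.

Lemma cutoff_gt0 (B : R) (x : V) : 0 < B -> (0 < cutoff B x) = (sqdist 0 x < B).
Proof. by move=> B0; rewrite /cutoff subr_gt0 mulrC ltr_pdivrMr // mul1r. Qed.

Lemma cutoff_ge0 (B : R) (x : V) : 0 < B -> (0 <= cutoff B x) = (sqdist 0 x <= B).
Proof. by move=> B0; rewrite /cutoff subr_ge0 mulrC ler_pdivrMr // mul1r. Qed.

Lemma cutoff_le1 (B : R) (x : V) : 0 < B -> cutoff B x <= 1.
Proof. by move=> B0; rewrite gerBl mulr_ge0 ?sqdist_ge0 // invr_ge0 ltW. Qed.

Lemma sum_cutoff1 (B : R) (x : V) : 0 < B ->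
  \sum_i cutoff1 B i x ^+ 2 = 4 * sqdist 0 x / B ^+ 2.
Proof.
move=> B0; rewrite /sqdist mulr_sumr mulr_suml; apply: eq_bigr => i _.
by rewrite /cutoff1 mxE; field; rewrite gt_eqF.
Qed.

Lemma sum_cutoff1_le (B : R) (x : V) : 0 < B -> sqdist 0 x <= B ->
  0 <= \sum_i cutoff1 B i x ^+ 2 <= 4 / B.
Proof.
move=> B0 hx; rewrite sum_cutoff1 // mulr_ge0 ?invr_ge0 ?sqr_ge0 ?mulr_ge0 ?sqdist_ge0 //=.
rewrite ler_pdivrMr ?exprn_gt0 // (_ : 4 / B * B ^+ 2 = 4 * B); last by field; rewrite gt_eqF.
by rewrite ler_pM2l.
Qed.

Variables (w : V -> R) (g : 'I_n -> V -> R) (H : 'I_n -> 'I_n -> V -> R).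
Variables (h h1 N : R -> R) (s tau b C1 : R).
Hypothesis dw : forall i x, is_derive x 'e_i w (g i x).
Hypothesis dg : forall i j x, is_derive x 'e_i (g j) (H i j x).
Hypothesis cH : forall i j, continuous (H i j).
Let Q x := \sum_j g j x ^+ 2.
Hypothesis trH : forall x, \sum_i H i i x = - Q x - h (w x).
Hypothesis dh : forall t : R, is_derive t (1 : R) h (h1 t).
Hypothesis ch1 : continuous h1.
Hypothesis h_gt0 : forall t, 0 < h t.
Hypothesis h1_le : forall t, h1 t <= b * h t.
Hypothesis dN : forall t : R, is_derive t (1 : R) N (2 * tau * (expR (- s * t) * h t)).
Hypothesis N_le : forall t, N t <= C1 * (expR (- s * t) * h t).
Hypothesis C1_gt0 : 0 < C1.
Hypothesis n_gt1 : (1 < n)%N.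
Hypothesis tau_le1 : tau <= 1.
Hypothesis A_gt0 : 0 < coefQ2 n%:R s.
Hypothesis B_ge0 : 0 <= coefQh n%:R s tau b.
Hypothesis D_gt0 : 0 < coefh2 n%:R tau.

Let cg j : continuous (g j).
Proof. exact: (partial_continuous (fun i x => dg i j x) (fun i => cH (i := i) (j := j))). Qed.

Let cw : continuous w.
Proof. exact: (partial_continuous dw cg). Qed.

Lemma dweight (t : R) : is_derive t (1 : R) (fun t => expR (- s * t)) (- s * expR (- s * t)).
Proof.
apply: (is_derive_eq (pd_exp (pd_scale (- s) (is_derive_id t (1 : R))))).
by rewrite /= mulr1 mulrC.
Qed.

(** Maximise the localised function and feed its derivative tests to [max_point_estimate]. [K] is
    uniform in [B]; the weight at the unknown point [x0] remains, to be controlled by a lower bound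
    on [w]. *)
Lemma gradient_estimate : 0 < N (w 0) ->
  exists2 K : R, 0 < K & forall B : R, 0 < B -> exists2 x0, sqdist 0 x0 <= B &
    N (w 0) <= expR (- s * w x0) * (K / B).
Proof.
move=> N0; have m1 : 1 < n%:R :> R by rewrite ltr1n.
have [K K0 hK] := max_point_estimate m1 tau_le1 C1_gt0 A_gt0 B_ge0 D_gt0.
exists K => // B B0.
pose E t := expR (- s * t).
have dE1 (t : R) : is_derive t (1 : R) (fun t => - s * E t) (s ^+ 2 * E t).
  by apply: (is_derive_eq (pd_scale (- s) (dweight t))); rewrite /E; ring.
have cE : continuous E by exact: (is_derive_continuous dweight).
have ch : continuous h by exact: (is_derive_continuous dh).
pose N2 t := 2 * tau * (E t * h1 t - s * E t * h t).
have dN1 (t : R) : is_derive t (1 : R) (fun t => 2 * tau * (E t * h t)) (N2 t).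
  apply: (is_derive_eq (pd_scale (2 * tau) (pd_mul (dweight t) (dh t)))).
  by rewrite /N2 /E; ring.
have cE2 : continuous (fun t => s ^+ 2 * E t) by apply: cts_mul => //; exact: cts_cst.
have cN2 : continuous N2.
  apply: cts_mul; first exact: cts_cst.
  apply: cts_add; first exact: cts_mul.
  by apply: cts_opp; apply: cts_mul => //; apply: cts_mul => //; exact: cts_cst.
pose a := loc w B E; pose bb := loc w B N.
have cQ : continuous Q by apply: cts_sum => j; apply: cts_sqr; exact: cg.
have ca : continuous a by apply: (cts_loc dw dg cH (B := B) dweight).
have cb : continuous bb by apply: (cts_loc dw dg cH (B := B) dN).
have cG : continuous (fun x => a x * Q x + bb x) by apply: cts_add => //; exact: cts_mul.
have [x0 hx0 xmax] := sqdist_ball_max 0 cG (ltW B0).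
have cut0 : cutoff B (0 : V) = 1 by rewrite /cutoff sqdistxx mulr0 subr0.
have Q_ge0 x : 0 <= Q x by apply: sumr_ge0 => j _; exact: sqr_ge0.
have Emax : N (w 0) <= a x0 * Q x0 + bb x0.
  have := xmax 0; rewrite sqdistxx => /(_ (ltW B0)); apply: le_trans.
  by rewrite /a /bb /loc cut0 expr1n !mul1r lerDr mulr_ge0 // expR_ge0.
exists x0 => //.
(* The maximum is at least [N (w 0) > 0], whereas the function vanishes where the cutoff does. *)
have cutx0 : 0 < cutoff B x0.
  rewrite lt_neqAle cutoff_ge0 // hx0 andbT; apply/negP => /eqP E0.
  by move: Emax; rewrite /a /bb /loc -E0 expr0n /= !mul0r addr0 leNgt N0.
have [r r0 hr] := sqdist_lt_nbhs (etrans (esym (cutoff_gt0 x0 B0)) cutx0).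
have hmax x : ball x0 r x -> a x * Q x + bb x <= a x0 * Q x0 + bb x0.
  by move=> /hr /ltW; exact: xmax.
pose psi x := - Q x - h (w x).
pose psi1 i x := - (\sum_j 2 * g j x * H i j x) - h1 (w x) * g i x.
have dpsi i x : is_derive x 'e_i psi (psi1 i x).
  exact: (pd_sub (pd_opp (pd_sum (fun j => pd_sqr (dg i j x)))) (is_derive_comp (dh (w x)) (dw i x))).
have cpsi1 i : continuous (psi1 i).
  apply: cts_add.
    apply: cts_opp; apply: cts_sum => j; apply: cts_mul; last exact: cH.
    by apply: cts_mul; [exact: cts_cst|exact: cg].
  by apply: cts_opp; apply: cts_mul; [exact: cts_comp|exact: cg].
have [first second] := local_max_bochner dw dg cH trH dpsi cpsi1
  (fun i x => pd_loc dw B dweight i x) (fun i x => pd_loc1 dw dg B dweight dE1 i x)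
  (fun i x => pd_loc dw B dN i x) (fun i x => pd_loc1 dw dg B dN dN1 i x)
  ca (fun i => cts_loc1 dw dg cH (B := B) dweight dE1 (i := i))
  (fun i => cts_loc2 dw dg cH (B := B) dweight dE1 cE2 (i := i))
  cb (fun i => cts_loc1 dw dg cH (B := B) dN dN1 (i := i))
  (fun i => cts_loc2 dw dg cH (B := B) dN dN1 cN2 (i := i)) r0 hmax.
have E0 : 0 < E (w x0) by exact: expR_gt0.
set Ew := E (w x0) in E0 *; set hw := h (w x0); set h1w := h1 (w x0).
set eta := cutoff B x0; rewrite -/eta in cutx0.
pose P := N (w x0) / Ew.
have NP : N (w x0) = Ew * P by rewrite /P mulrC divfK // gt_eqF.
pose y i := cutoff1 B i x0.
pose u i := \sum_j g j x0 * H j i x0.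
pose q := \sum_i g i x0 * u i; pose my := \sum_i y i * u i.
pose yg := \sum_i y i * g i x0; pose y2 := \sum_i y i ^+ 2.
have ui i : 2 * eta * u i = eta * (s * Q x0 - 2 * tau * hw) * g i x0 - 2 * (Q x0 + P) * y i.
  apply: (@first_order_scalar _ Ew); rewrite ?gt_eqF // -NP; exact: first.
(* Pairing the first-order conditions with [g] and with [y] gives the identities for [q] and
   [my]. *)
have lin (c1 c2 : R) (v : 'I_n -> R) :
    (forall i, 2 * eta * u i = c1 * g i x0 - c2 * y i) ->
    2 * eta * \sum_i v i * u i = c1 * (\sum_i v i * g i x0) - c2 * \sum_i v i * y i.
  move=> hu; rewrite !mulr_sumr -sumrN -big_split /=; apply: eq_bigr => i _.
  by rewrite mulrCA hu; ring.
have Eq : 2 * eta * q = eta * (s * Q x0 - 2 * tau * hw) * Q x0 - 2 * (Q x0 + P) * yg.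
  rewrite /q (lin _ _ _ ui); congr (_ * _ - _ * _); apply: eq_bigr => i _; exact: mulrC.
have Emy : 2 * eta * my = eta * (s * Q x0 - 2 * tau * hw) * yg - 2 * (Q x0 + P) * y2.
  exact: (lin _ _ _ ui).
pose m2 := \sum_i \sum_j H j i x0 ^+ 2.
have hm2 al ga : 2 * al * (- Q x0 - hw) + 2 * ga * q - n%:R * al ^+ 2
        - 2 * al * ga * Q x0 - ga ^+ 2 * Q x0 ^+ 2 <= m2.
  rewrite -trH; exact: (matrix_sqr_lower (fun i j => H i j x0) (fun i => g i x0)).
have y2B := sum_cutoff1_le B0 hx0.
have main : Ew * (2 * eta ^+ 2 * (m2 - 2 * q - h1w * Q x0) - 4 * s * eta ^+ 2 * q + 8 * eta * my
    + Q x0 * (eta ^+ 2 * (s ^+ 2 * Q x0 + s * (Q x0 + hw)) - 4 * s * eta * yg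
           + (2 * y2 + 2 * eta * (- (2 * n%:R / B))))
    + eta ^+ 2 * (2 * tau * (h1w - s * hw) * Q x0 - 2 * tau * hw * (Q x0 + hw))
    + 8 * tau * eta * hw * yg + P * (2 * y2 + 2 * eta * (- (2 * n%:R / B)))) <= 0.
  move: second; rewrite !sum_loc2 trH.
  have -> : \sum_j g j x0 * psi1 j x0 = - 2 * q - h1w * Q x0.
    have -> : q = \sum_j \sum_i g i x0 * (g j x0 * H j i x0).
      rewrite exchange_big; apply: eq_bigr => i _ /=.
      by rewrite /u mulr_sumr; apply: eq_bigr => j _; ring.
    rewrite /Q !mulr_sumr -sumrN -big_split /=; apply: eq_bigr => j _.
    rewrite /psi1 mulrDr mulrN mulr_sumr mulr_sumr -sumrN; congr (_ + _).
      by apply: eq_bigr => i _; ring.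
    by rewrite -/h1w; ring.
  set cross := \sum_i 2 * _ * _.
  have crossE : cross = Ew * (- 4 * s * eta ^+ 2 * q + 8 * eta * my).
    rewrite /cross /q /my !mulr_sumr -big_split /= mulr_sumr; apply: eq_bigr => i _.
    have id2 (e et a1 a2 a3 : R) : 2 * (et ^+ 2 * (- s * e * a1) + e * (2 * et * a2)) * (2 * a3)
      = e * (- 4 * s * et ^+ 2 * (a1 * a3) + 8 * et * (a2 * a3)) by ring.
    exact: id2.
  by rewrite -(second_order_scalar m2 h1w (Q x0) tau hw P yg y2 (2 * n%:R / B) crossE) -NP.
rewrite pmulr_rle0 // in main.
have PC : P <= C1 * hw.
  by rewrite /P ler_pdivrMr // -mulrA [hw * _]mulrC; exact: N_le.
have ygQ : yg ^+ 2 <= y2 * Q x0 by exact: sum_cauchy_schwarz.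
have etaB : 0 < eta <= 1 by rewrite cutx0 cutoff_le1.
have fin := hK _ _ _ _ _ _ _ _ _ _ _ B0 (Q_ge0 x0) (h_gt0 _) (h1_le _) PC etaB y2B ygQ hm2 Eq Emy main.
apply: le_trans Emax _; rewrite /a /bb /loc -/eta -/Ew NP.
rewrite (_ : _ + _ = Ew * (eta ^+ 2 * (Q x0 + P))); last by ring.
by rewrite ler_pM2l.
Qed.

End estimate.

(** * Choice of the exponents in the subcritical range *)

(** For [s > 0], [coefQ2] is positive exactly when [s < 2 / (m - 2)]. At [tau = 1 / m], [coefQh]
    equals [G / m], whose sign asks for [s] above the second entry of [l]. The two constraints on
    [s] are compatible precisely because [b < 4 / (m - 2)]. *)
Lemma subcritical_parameters (R : realType) (m b : R) :
  3 <= m -> 0 < b -> b < 4 / (m - 2) ->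
  exists s tau k : R, [/\ 0 < s < b, 0 < tau <= 1, s * k < 1 /\ 0 < k, m < 2 * k + 2 &
    [/\ 0 < coefQ2 m s, 0 <= coefQh m s tau b & 0 < coefh2 m tau]].
Proof.
move=> m3 b0 bm.
have m2 : 0 < m - 2 by lra.
have bm' : b * (m - 2) < 4 by rewrite -ltr_pdivlMr.
pose l := Num.max 0 (((m - 1) * b - 3) / (m / 2 + 1)).
pose r := Num.min (2 / (m - 2)) b.
have d0 : 0 < m / 2 + 1 by lra.
have lr : l < r.
  have r2 : 0 < 2 / (m - 2) by rewrite divr_gt0.
  rewrite /l /r lt_min !gt_max r2 b0 /=; apply/andP; split.
    by rewrite ltr_pdivrMr // mulrAC ltr_pdivlMr //; nra.
  by rewrite ltr_pdivrMr //; nra.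
have [s sl sr] : exists2 s, l < s & s < r by exists ((l + r) / 2); lra.
move: sl; rewrite /l gt_max ltr_pdivrMr // => /andP[s0 sG].
move: sr; rewrite /r lt_min ltr_pdivlMr // => /andP[sm sb].
pose G := s * (m / 2 + 1) - ((m - 1) * b - 3).
have G0 : 0 < G by rewrite /G; lra.
have b1 : 0 < 1 + b by lra.
(* [tau] will be [(1 - d) / m]: [d > 0] makes [coefh2] positive, [1 / 2] keeps [tau] positive, and
   the second bound keeps [coefQh] nonnegative. *)
pose d := Num.min (1 / 2) (G / (1 + b)).
have d0' : 0 < d by rewrite lt_min divr_gt0 // divr_gt0.
have d12 : d <= 1 / 2 by rewrite ge_min lexx.
have dG : d * (1 + b) <= G by rewrite -ler_pdivlMr // ge_min lexx orbT.
have mp : 0 < m by lra.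
have m1 : 0 < m - 1 by lra.
(* [k] is the midpoint between its two constraints, [(m - 2) / 2 < k] and [k < 1 / s]. *)
exists s, ((1 - d) / m), (((m - 2) / 2 + s^-1) / 2).
have si : s^-1 * s = 1 by rewrite mulVf // gt_eqF.
have si0 : 0 < s^-1 by rewrite invr_gt0.
split.
- by rewrite s0.
- by rewrite divr_gt0 /=; [rewrite ler_pdivrMr //; lra|lra|].
- by split; lra.
- suff : (m - 2) / 2 < s^-1 by lra.
  by rewrite -(ltr_pM2r s0) si; lra.
split.
- rewrite /coefQ2 mulr_gt0 //; first by lra.
  by rewrite subr_gt0 ltr_pdivlMr //; lra.
- have -> : coefQh m s ((1 - d) / m) b =
     (G - d * (1 + b) + d * ((2 + s) / (m - 1))) / m.
    by rewrite /coefQh /G; field; rewrite !gt_eqF.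
  rewrite divr_ge0 ?(ltW mp) // addr_ge0 ?subr_ge0 // mulr_ge0 ?(ltW d0') //.
  by rewrite divr_ge0; lra.
- rewrite /coefh2 (_ : 1 - m * _ = d) ?divr_gt0 //.
  by field; rewrite gt_eqF.
Qed.

(** * The Keller-Osserman argument for negative [h] *)

Section keller_osserman.
Context {R : realType} {n : nat}.
Local Notation V := 'rV[R]_n.
Variables (w : V -> R) (g : 'I_n -> V -> R) (H : 'I_n -> 'I_n -> V -> R).
Variables (h : R -> R) (c b : R).
Hypothesis dw : forall i x, is_derive x 'e_i w (g i x).
Hypothesis dg : forall i x, is_derive x 'e_i (g i) (H i i x).
Hypothesis cw : continuous w.
Hypothesis trH : forall x, \sum_i H i i x = - (\sum_j g j x ^+ 2) - h (w x).
Hypothesis c_gt0 : 0 < c.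
Hypothesis b_gt0 : 0 < b.
Hypothesis h_le : forall t, c * expR (b * t) <= - h t.

(** At a maximum of [cutoff * exp (k w)] the gradient of [w] is expressed by that of the cutoff, and
    what remains of the second-order test bounds [- h]. The exponent [k = b / 2] makes the square of
    the maximised function match the lower bound on [- h]. *)
Lemma keller_osserman_bound (B : R) : 0 < B ->
  b / 2 * c * expR (b * w 0) <= (4 * (2 / b) + 8 + 2 * n%:R) / B.
Proof.
move=> B0; pose k := b / 2; have k0 : 0 < k by rewrite divr_gt0.
pose G x := cutoff B x * expR (k * w x).
pose G1 i x := cutoff B x * (expR (k * w x) * (k * g i x)) + expR (k * w x) * cutoff1 B i x.
pose G2 i x := (cutoff B x * (k ^+ 2 * g i x ^+ 2 + k * H i i x)
   + 2 * k * (cutoff1 B i x * g i x) - 2 * B^-1) * expR (k * w x).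
have dE i x : is_derive x 'e_i (fun x => expR (k * w x)) (expR (k * w x) * (k * g i x)).
  exact: (pd_exp (pd_scale k (dw i x))).
have dG i x : is_derive x 'e_i G (G1 i x) by exact: (pd_mul (pd_cutoff B i x) (dE i x)).
have dG1 i x : is_derive x 'e_i (G1 i) (G2 i x).
  apply: (is_derive_eq (pd_add (pd_mul (pd_cutoff B i x) (pd_mul (dE i x) (pd_scale k (dg i x))))
     (pd_mul (dE i x) (pd_cutoff1 B i x)))).
  by rewrite /G2; ring.
have cG : continuous G.
  apply: cts_mul; first exact: cts_cutoff.
  apply: (@cts_comp _ _ (fun t => expR t) (fun x => k * w x)); first exact: continuous_expR.
  by apply: cts_mul => //; exact: cts_cst.
have [x0 hx0 xmax] := sqdist_ball_max 0 cG (ltW B0).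
have G0 : expR (k * w 0) <= G x0.
  have := xmax 0; rewrite sqdistxx => /(_ (ltW B0)).
  by rewrite {1}/G /cutoff sqdistxx mulr0 subr0 mul1r.
have cut0 : 0 < cutoff B x0.
  by have := lt_le_trans (expR_gt0 _) G0; rewrite /G pmulr_lgt0 // expR_gt0.
have [r r0 hr] := sqdist_lt_nbhs (etrans (esym (cutoff_gt0 x0 B0)) cut0).
have crit i : G1 i x0 = 0 /\ G2 i x0 <= 0.
  by apply: (local_max_second_order r0 (dG i) (dG1 i x0)) => y /hr /ltW; exact: xmax.
set eta := cutoff B x0 in cut0; pose y i := cutoff1 B i x0.
pose y2 := \sum_i y i ^+ 2; pose Q := \sum_i g i x0 ^+ 2.
have gy i : k * eta * g i x0 = - y i.
  have [+ _] := crit i; rewrite /G1 -/eta -/(y i) => E1.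
  have e0 := expR_gt0 (k * w x0); have {}e0 : expR (k * w x0) != 0 by rewrite gt_eqF.
  apply: (mulfI e0); apply/eqP; rewrite -subr_eq0 -[X in _ == X]E1; apply/eqP; ring.
have Qy : (k * eta) ^+ 2 * Q = y2.
  by rewrite /Q /y2 mulr_sumr; apply: eq_bigr => i _; rewrite -exprMn gy sqrrN.
have ygy : k * eta * (\sum_i y i * g i x0) = - y2.
  rewrite /y2 mulr_sumr -sumrN; apply: eq_bigr => i _.
  by rewrite mulrCA gy; ring.
have second : eta * (k ^+ 2 * Q + k * (- Q - h (w x0)))
   + 2 * k * (\sum_i y i * g i x0) - 2 * n%:R / B <= 0.
  rewrite -trH (_ : 2 * n%:R / B = \sum_(i < n) 2 * B^-1); last first.
    by rewrite sumr_const card_ord -mulr_natl; ring.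
  rewrite /Q !mulr_sumr -big_split /= mulr_sumr -sumrN -!big_split /=.
  apply: sumr_le0 => i _; have [_] := crit i; rewrite /G2 pmulr_lle0 ?expR_gt0 //.
have /andP[y20 y2B] : 0 <= y2 <= 4 / B by exact: sum_cutoff1_le.
have Q0 : 0 <= Q by apply: sumr_ge0 => i _; exact: sqr_ge0.
have eta1 : eta <= 1 by exact: cutoff_le1.
have hh := h_le (w x0).
have hG : c * G x0 ^+ 2 <= eta ^+ 2 * - h (w x0).
  rewrite /G -/eta exprMn -expRM_natl (_ : 2%:R * (k * w x0) = b * w x0); last by rewrite /k; lra.
  by rewrite mulrCA ler_wpM2l ?sqr_ge0.
have GG : expR (b * w 0) <= G x0 ^+ 2.
  rewrite (_ : b * w 0 = 2%:R * (k * w 0)); last by rewrite /k; lra.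
  by rewrite expRM_natl ler_sqr ?nnegrE ?expR_ge0 // (le_trans (expR_ge0 _) G0).
(* The extra factor [eta] produces [eta ^+ 2 * - h], which [hG] compares with the square of the
   maximum. *)
have e2 : eta * (eta * (k ^+ 2 * Q + k * (- Q - h (w x0)))
   + 2 * k * (\sum_i y i * g i x0) - 2 * n%:R / B) <= 0.
  by rewrite pmulr_rle0.
have e3 : k * eta ^+ 2 * Q = 2 / b * y2.
  by rewrite -Qy /k; field; rewrite gt_eqF.
have nB : eta * (2 * n%:R / B) <= 2 * n%:R / B.
  by rewrite ler_piMl // divr_ge0 ?(ltW B0) // mulr_ge0.
have b2 : 0 <= 2 / b by rewrite divr_ge0 // ltW.
have p1 : 2 / b * y2 <= 2 / b * (4 / B) by rewrite ler_wpM2l.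
have p2 : k * (c * expR (b * w 0)) <= k * (eta ^+ 2 * - h (w x0)).
  rewrite ler_pM2l //; apply: le_trans hG; by rewrite ler_pM2l.
have p3 : 0 <= (k * eta) ^+ 2 * Q by rewrite mulr_ge0 ?sqr_ge0.
have goalE : (4 * (2 / b) + 8 + 2 * n%:R) / B = 2 / b * (4 / B) + 2 * (4 / B) + 2 * n%:R / B.
  by ring.
rewrite goalE -/k -mulrA; apply: le_trans p2 _.
move: (w x0) (2 / b) (4 / B) (2 * n%:R / B) (\sum_i y i * g i x0) e2 ygy e3 nB p1 p3 y2B.
by clearbody k eta y2 Q => t b' B4 S yg e2 ygy e3 nB p1 p3 y2B; lra.
Qed.

Lemma keller_osserman : False.
Proof.
pose C := 4 * (2 / b) + 8 + 2 * n%:R; pose D := b / 2 * c * expR (b * w 0).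
have C0 : 0 < C.
  have b2 : 0 < 2 / b by rewrite divr_gt0.
  by rewrite /C; have := ler0n R n; lra.
have D0 : 0 < D by rewrite /D !mulr_gt0 // ?expR_gt0 // divr_gt0.
(* For this [B] the bound reads [D <= D / 2]. *)
have B0 : 0 < 2 * C / D by rewrite divr_gt0 // mulr_gt0.
have := keller_osserman_bound B0; rewrite -/C -/D.
rewrite (_ : C / (2 * C / D) = D / 2); first by lra.
by field; rewrite !gt_eqF.
Qed.

End keller_osserman.

(** * Polynomial lower bounds for positive superharmonic functions *)

Section superharmonic.
Context {R : realType} {n : nat}.
Local Notation V := 'rV[R]_n.

(** This is [(1 + |x|^2)^(-k)] with a real exponent. Differentiation raises [k] by one, and [bumpS]
    brings different exponents to a common one. *)
Definition bump (k : R) (x : V) : R := expR (- k * ln (1 + sqdist 0 x)).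

Definition bump1 (k : R) (i : 'I_n) (x : V) : R := - (2 * k) * (x 0 i * bump (k + 1) x).

Definition bump2 (k : R) (i : 'I_n) (x : V) : R :=
  - (2 * k) * (bump (k + 1) x - 2 * (k + 1) * (x 0 i ^+ 2 * bump (k + 2) x)).

Lemma sqdist1_gt0 (x : V) : 0 < 1 + sqdist 0 x.
Proof. by rewrite ltr_pwDl // sqdist_ge0. Qed.

Lemma bumpS (k : R) (x : V) : bump k x = (1 + sqdist 0 x) * bump (k + 1) x.
Proof.
rewrite /bump -{2}[1 + sqdist 0 x]lnK ?posrE ?sqdist1_gt0 // -expRD.
by congr expR; ring.
Qed.

Lemma pd_bump k i x : is_derive x 'e_i (bump k) (bump1 k i x).
Proof.
have dZ := pd_add (pd_cst 1 x 'e_i) (pd_sqdist 0 i x).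
have dln := @is_derive_comp R _ (@ln R) (fun y : V => 1 + sqdist 0 y) _ _ _ _ (is_derive1_ln (sqdist1_gt0 x)) dZ.
apply: (is_derive_eq (pd_exp (pd_scale (- k) dln))).
rewrite /bump1 -/(bump k x) bumpS mxE; field.
by rewrite gt_eqF // sqdist1_gt0.
Qed.

Lemma pd_bump1 k i x : is_derive x 'e_i (bump1 k i) (bump2 k i x).
Proof.
apply: (is_derive_eq (pd_scale (- (2 * k)) (pd_mul (pd_coord i i x) (pd_bump (k + 1) i x)))).
rewrite /bump2 /bump1 eqxx (_ : k + 1 + 1 = k + 2); last by ring.
by rewrite /=; ring.
Qed.

Lemma cts_bump k : continuous (bump k).
Proof.
move=> x; apply: (@continuous_comp _ _ _ (fun x => - k * ln (1 + sqdist 0 x)) expR); last exact: continuous_expR.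
apply: (@continuous_comp _ _ _ (fun x : V => 1 + sqdist 0 x) (fun z => - k * ln z)).
  by apply: cts_add; [exact: cts_cst|exact: continuous_sqdist].
apply: cvgM; first exact: cvg_cst.
by apply: continuous_ln; exact: sqdist1_gt0.
Qed.

Lemma sum_bump2 k x : \sum_i bump2 k i x =
  2 * k * bump (k + 2) x * ((2 * k + 2 - n%:R) * (1 + sqdist 0 x) - (2 * k + 2)).
Proof.
rewrite /bump2 -mulr_sumr sumrB sumr_const card_ord -!mulr_sumr -mulr_suml.
rewrite -[bump _ x *+ n]mulr_natl [bump (k + 1) x]bumpS (_ : k + 1 + 1 = k + 2); last by ring.
have -> : \sum_(i < n) x 0 i ^+ 2 = sqdist 0 x.
  by apply: eq_bigr => i _; rewrite mxE subr0.
by ring.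
Qed.

Variables (u : V -> R) (u1 u2 : 'I_n -> V -> R).
Hypothesis du : forall i x, is_derive x 'e_i u (u1 i x).
Hypothesis du1 : forall i x, is_derive x 'e_i (u1 i) (u2 i x).
Hypothesis cu : continuous u.
Hypothesis u_gt0 : forall x, 0 < u x.
Hypothesis u2_lt0 : forall x, \sum_i u2 i x < 0.

(* Comparison with m ((1 + |x|^2)^-k - rho^-k), which is subharmonic away from a
   fixed ball as soon as k > (n - 2)/2. *)
Lemma superharmonic_lower_bound (k : R) : 0 < k -> n%:R < 2 * k + 2 ->
  exists2 c : R, 0 < c & forall (B : R) x, 0 < B -> sqdist 0 x <= B ->
    c * expR (- k * ln (1 + B)) <= u x.
Proof.
move=> k0 kn; have d0 : 0 < 2 * k + 2 - n%:R by lra.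
(* By [sum_bump2], the Laplacian of [bump k] is nonnegative where [sqdist 0 x] exceeds [Z0]. *)
pose Z0 := (2 * k + 2) / (2 * k + 2 - n%:R).
have Z00 : 0 < Z0 by rewrite divr_gt0 //; lra.
have [p hp pmin] := sqdist_ball_max 0 (cts_opp cu) (ltW Z00).
have m0 := u_gt0 p; set m := u p in m0 pmin.
have e2 : expR (- k * ln 2) < 1 :> R.
  by rewrite expR_lt1 mulNr oppr_lt0 mulr_gt0 // ln_gt0 // ltr1n.
exists (m * (1 - expR (- k * ln 2))); first by rewrite mulr_gt0 // subr_gt0.
(* The factor 2 leaves room: the boundary value [rho^-k] is [2^-k] times [(1 + B)^-k], which yields
   the constant [1 - 2^-k]. *)
move=> B x B0 hx; pose rho := 2 * (1 + B).
have rho0 : 0 < rho by rewrite /rho; lra.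
pose G y := m * bump k y - u y.
have cG : continuous G.
  by apply: cts_add; [apply: cts_mul; [exact: cts_cst|exact: cts_bump]|exact: cts_opp].
have rho1 : 0 <= rho - 1 by rewrite /rho; lra.
have [x0 hx0 xmax] := sqdist_ball_max 0 cG rho1.
have bump_le1 y : bump k y <= 1.
  rewrite /bump expR_le1 mulNr oppr_le0 mulr_ge0 ?(ltW k0) // ln_ge0 //.
  by rewrite lerDl sqdist_ge0.
have Gx0 : G x0 <= m * expR (- k * ln rho).
  have [lt|] := ltP (sqdist 0 x0) (rho - 1); last first.
    move=> ge; have E : 1 + sqdist 0 x0 = rho by lra.
    by rewrite /G /bump E gerBl ltW.
  have [leZ|gtZ] := leP (sqdist 0 x0) Z0.
    have := pmin x0 leZ; rewrite lerN2 => mu.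
    apply: (@le_trans _ _ 0); last by rewrite mulr_ge0 ?expR_ge0 // ltW.
    rewrite /G subr_le0; apply: le_trans mu; rewrite -[leRHS]mulr1.
    by rewrite ler_pM2l.
  (* An interior maximum beyond [Z0] would have a nonpositive Laplacian, yet [m * bump k] is
     subharmonic there and [u] strictly superharmonic. *)
  exfalso; have [r r0 hr] := sqdist_lt_nbhs lt.
  have crit i : m * bump2 k i x0 - u2 i x0 <= 0.
    have dG y : is_derive y 'e_i G (m * bump1 k i y - u1 i y).
      exact: (pd_sub (pd_scale m (pd_bump k i y)) (du i y)).
    have dG1 := pd_sub (pd_scale m (pd_bump1 k i x0)) (du1 i x0).
    have [] := local_max_second_order r0 dG dG1; last by [].
    by move=> y /hr /ltW; exact: xmax.
  have : \sum_i (m * bump2 k i x0 - u2 i x0) <= 0 by apply: sumr_le0 => i _.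
  rewrite sumrB -mulr_sumr sum_bump2 leNgt => /negP; apply.
  rewrite subr_gt0; apply: lt_le_trans (u2_lt0 x0) _.
  rewrite mulr_ge0 ?(ltW m0) // mulr_ge0 //.
    by rewrite mulr_ge0 ?expR_ge0 // mulr_ge0 // ltW.
  move: gtZ; rewrite /Z0 ltr_pdivrMr // => gtZ; lra.
have hxr : sqdist 0 x <= rho - 1 by rewrite /rho; lra.
have := le_trans (xmax x hxr) Gx0; rewrite /G.
have lnrho : expR (- k * ln rho) = expR (- k * ln 2) * expR (- k * ln (1 + B)).
  by rewrite -expRD -mulrDr -lnM ?posrE //; lra.
have bx : expR (- k * ln (1 + B)) <= bump k x.
  rewrite /bump ler_expR !mulNr lerN2 ler_pM2l // ler_ln ?posrE ?sqdist1_gt0 //; lra.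
have : m * expR (- k * ln (1 + B)) <= m * bump k x by rewrite ler_pM2l.
by rewrite lnrho; lra.
Qed.

End superharmonic.

(** * Nonexistence for positive [h] *)

Lemma derive_le0_le (R : realType) (F F1 : R -> R) (a : R) :
  (forall t : R, is_derive t (1 : R) F (F1 t)) -> (forall t, a < t -> F1 t <= 0) ->
  forall t, a <= t -> F t <= F a.
Proof.
move=> dF F10 t; rewrite le_eqVlt => /predU1P[-> //|at_].
have [|c + E] := @MVT R F F1 a t at_ (fun z _ => dF z).
  exact: (continuous_subspaceT (is_derive_continuous dF)).
rewrite in_itv /= => /andP[ac _]; rewrite -subr_le0 E mulr_le0_ge0 ?F10 //.
by rewrite subr_ge0 ltW.
Qed.

Section no_positive_solution.
Context {R : realType} {n : nat}.
Local Notation V := 'rV[R]_n.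
Variables (w : V -> R) (g : 'I_n -> V -> R) (H : 'I_n -> 'I_n -> V -> R).
Variables (h h1 : R -> R) (b c1 : R).
Hypothesis n_gt2 : (2 < n)%N.
Hypothesis dw : forall i x, is_derive x 'e_i w (g i x).
Hypothesis dg : forall i j x, is_derive x 'e_i (g j) (H i j x).
Hypothesis cH : forall i j, continuous (H i j).
Hypothesis trH : forall x, \sum_i H i i x = - (\sum_j g j x ^+ 2) - h (w x).
Hypothesis dh : forall t : R, is_derive t (1 : R) h (h1 t).
Hypothesis ch1 : continuous h1.
Hypothesis b_gt0 : 0 < b.
Hypothesis b_lt : b < 4 / (n%:R - 2).
Hypothesis h1_le : forall t, h1 t <= b * h t.
Hypothesis c1_gt0 : 0 < c1.
Hypothesis h_ge : forall t, c1 * expR (b * t) <= h t.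

Let h_gt0 t : 0 < h t.
Proof. by apply: lt_le_trans (h_ge t); rewrite mulr_gt0 // expR_gt0. Qed.

(* P = exp (s t) N t is only positive above the level s0, and there it is
   controlled by h because h t * exp (- b t) is nonincreasing. *)
Lemma antiderivative_bound (s tau s0 : R) (N : R -> R) : 0 < tau -> s < b ->
  (forall t : R, is_derive t (1 : R) N (2 * tau * (expR (- s * t) * h t))) ->
  N s0 = 0 ->
  exists2 C : R, 0 < C & forall t, N t <= C * (expR (- s * t) * h t).
Proof.
move=> tau0 sb dN N0.
pose K := h s0 * expR (- b * s0).
have K0 : 0 < K by rewrite mulr_gt0 // expR_gt0.
have hK t : s0 <= t -> h t <= K * expR (b * t).
  have dF (z : R) := pd_mul (dh z) (pd_exp (pd_scale (- b) (is_derive_id z (1 : R)))).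
  move=> st; have := derive_le0_le dF _ st.
  rewrite -/K => kk; have {kk} : h t * expR (- b * t) <= K.
    apply: kk => z _ /=; rewrite mulr1.
    rewrite (_ : _ + _ = expR (- b * z) * (h1 z - b * h z)); last by ring.
    by rewrite pmulr_rle0 ?expR_gt0 // subr_le0.
  rewrite mulNr expRN ler_pdivrMr ?expR_gt0 //.
(* Then [M exp ((b - s) t)] has derivative [2 tau K exp ((b - s) t)], which dominates [N'] beyond
   [s0]. *)
pose M := 2 * tau * K / (b - s).
have bs : 0 < b - s by rewrite subr_gt0.
have M0 : 0 < M by apply: divr_gt0 => //; apply: mulr_gt0 => //; exact: mulr_gt0.
have split_exp t : expR ((b - s) * t) = expR (- s * t) * expR (b * t).
  by rewrite -expRD; congr expR; ring.
exists (M / c1) => [|t]; first by rewrite divr_gt0.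
have rhs0 : 0 <= M / c1 * (expR (- s * t) * h t).
  by rewrite ltW // !mulr_gt0 ?invr_gt0 ?expR_gt0.
have [st|/ltW ts] := leP s0 t; last first.
  (* Below [s0], [N <= 0] because [N] increases; the reflection is there because [derive_le0_le]
     compares only to the right. *)
  have dNN z : is_derive z (1 : R) (fun t => - N (- t)) (2 * tau * (expR (- s * - z) * h (- z))).
    have dm := pd_opp (is_derive_id z (1 : R)).
    apply: (is_derive_eq (pd_opp (@is_derive_comp _ _ N (fun t : R => - t) z 1 _ _ (dN (- z)) dm))).
    by ring.
  apply: le_trans rhs0.
  have dNN' z := pd_opp (dNN z).
  have := @derive_le0_le R _ _ (- s0) dNN' _ (- t); rewrite lerN2 !opprK N0.
  apply=> // z _; rewrite oppr_le0 !mulr_ge0 ?expR_ge0 // ltW //.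
have dF (z : R) := pd_sub (dN z) (pd_scale M (pd_exp (pd_scale (b - s) (is_derive_id z (1 : R))))).
have := derive_le0_le dF _ st; rewrite N0 sub0r => kk.
have {kk} : N t - M * expR ((b - s) * t) <= - (M * expR ((b - s) * s0)).
  apply: kk => z sz /=; rewrite mulr1 subr_le0 split_exp.
  have -> : M * (expR (- s * z) * expR (b * z) * (b - s)) =
      2 * tau * (expR (- s * z) * (K * expR (b * z))).
    by rewrite /M; field; rewrite gt_eqF.
  by rewrite !ler_pM2l ?mulr_gt0 ?expR_gt0 // hK // ltW.
have : 0 < M * expR ((b - s) * s0) by rewrite mulr_gt0 // expR_gt0.
have : M * expR ((b - s) * t) <= M / c1 * (expR (- s * t) * h t).
  rewrite split_exp mulrA (_ : M / c1 * _ = M * expR (- s * t) * (h t / c1)); last by ring.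
  have ME : 0 < M * expR (- s * t) by apply: mulr_gt0 => //; exact: expR_gt0.
  by rewrite ler_pM2l // ler_pdivlMr // mulrC.
lra.
Qed.

Lemma no_positive_solution : False.
Proof.
have n3 : 3 <= n%:R :> R by rewrite ler_nat.
have [s [tau [k [/andP[s0 sb] /andP[tau0 tau1] [sk k0] kn [A0 B0 D0]]]]] :=
  subcritical_parameters n3 b_gt0 b_lt.
pose phi t := 2 * tau * (expR (- s * t) * h t).
have cphi : continuous phi.
  apply: cts_mul; first exact: cts_cst.
  apply: cts_mul; last exact: (is_derive_continuous dh).
  exact: (is_derive_continuous (dweight s)).
(* A base level below [w 0] makes [N (w 0)] positive. *)
have [N dN N0] := continuous_antiderivative (w 0 - 1) cphi.
have [C C0 hC] := antiderivative_bound tau0 sb dN N0.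
have Nw : 0 < N (w 0).
  have [t [t0 t1]] := derive_mvt (w 0 - 1) dN ltr01.
  rewrite N0 subr0 [1 *: 1]mulr1 subrK mulr1 => ->.
  by rewrite /phi !mulr_gt0 // expR_gt0.
have [K K0 hK] := gradient_estimate dw dg cH trH dh ch1 h_gt0 h1_le dN hC C0
  (ltnW n_gt2) tau1 A0 B0 D0 Nw.
have cg j : continuous (g j).
  exact: (partial_continuous (fun i x => dg i j x) (fun i => cH (i := i) (j := j))).
have cw : continuous w by exact: (partial_continuous dw cg).
have cu : continuous (fun x => expR (w x)) by apply: cts_comp => //; exact: continuous_expR.
have du i x := pd_exp (dw i x).
have du1 i x := pd_mul (pd_exp (dw i x)) (dg i i x).
have u2_lt0 x : \sum_i (expR (w x) * H i i x + g i x * (expR (w x) * g i x)) < 0.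
  have -> : \sum_i (expR (w x) * H i i x + g i x * (expR (w x) * g i x)) =
      expR (w x) * (\sum_i H i i x + \sum_i g i x ^+ 2).
    by rewrite -big_split /= mulr_sumr; apply: eq_bigr => i _; ring.
  by rewrite trH addrAC addNr add0r mulrN oppr_lt0 mulr_gt0 // expR_gt0.
have [c c0 hc] := superharmonic_lower_bound du du1 cu (fun x => expR_gt0 (w x)) u2_lt0 k0 kn.
pose A := 2 * K * expR (- s * ln c); have A0' : 0 < A by rewrite !mulr_gt0 // expR_gt0.
have sk0 : 0 < s * k by rewrite mulr_gt0.
have sk1 : 0 < 1 - s * k by rewrite subr_gt0.
(* [L] will be [ln (1 + B)]. The estimates give [N (w 0) * expR M <= A], and [expR M >= 1 + M] turns
   this into [2 * N (w 0) + A <= A]. *)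
pose M := 1 + A / N (w 0); pose L := M / (1 - s * k).
have AN : 0 < A / N (w 0) by rewrite divr_gt0.
have L1 : 1 <= L by rewrite /L ler_pdivlMr // mul1r /M; lra.
have eL : 2 <= expR L by apply: le_trans (expR_ge1Dx L); lra.
pose B := expR L - 1; have B_gt0 : 0 < B by rewrite /B; lra.
have [x0 hx0 est] := hK B B_gt0.
have := hc B x0 B_gt0 hx0.
rewrite (_ : 1 + B = expR L) /B; last by ring.
rewrite expRK => low.
have wlow : ln c - k * L <= w x0.
  have -> : ln c - k * L = ln (c * expR (- k * L)).
    by rewrite lnM ?posrE ?expR_gt0 // expRK mulNr.
  by rewrite -[leRHS]expRK ler_ln ?posrE ?expR_gt0 // mulr_gt0 // expR_gt0.
have est2 : expR (- s * w x0) <= expR (- s * ln c) * expR (s * k * L).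
  rewrite -expRD ler_expR.
  have : s * (ln c - k * L) <= s * w x0 by rewrite ler_pM2l.
  lra.
have BL : K / B <= 2 * K * expR (- L).
  rewrite ler_pdivrMr // expRN mulrAC ler_pdivlMr ?expR_gt0 //.
  have : K * 2 <= K * expR L by rewrite ler_pM2l.
  by rewrite /B; lra.
have est3 : N (w 0) <= A * expR (- ((1 - s * k) * L)).
  apply: le_trans est _.
  apply: le_trans (ler_pM (expR_ge0 _) _ est2 BL) _; first by rewrite divr_ge0 // ltW.
  have -> : - ((1 - s * k) * L) = s * k * L + - L by ring.
  by rewrite /A expRD le_eqVlt; apply/orP; left; apply/eqP; ring.
have LM : (1 - s * k) * L = M by rewrite /L mulrC divfK // gt_eqF.
move: est3; rewrite LM expRN ler_pdivlMr ?expR_gt0 // => est4.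
have : N (w 0) * (1 + M) <= A.
  by apply: le_trans est4; rewrite ler_pM2l // expR_ge1Dx.
have -> : N (w 0) * (1 + M) = 2 * N (w 0) + A.
  by rewrite /M; field; rewrite gt_eqF.
lra.
Qed.

End no_positive_solution.

(** * The nonlinearity in logarithmic variables *)

Section nonlinearity.
Context {R : realType}.
Variables (f : R -> R) (beta c1 : R).
Hypothesis f_derivable : forall s : R, 0 < s -> derivable f s 1.
Hypothesis f'_cont : {within `]0, +oo[, continuous (f^`())%classic}.
Hypothesis f_growth : forall s : R, 0 < s -> 0 <= beta * f s - s * (f^`())%classic s.
Hypothesis c1_gt0 : 0 < c1.
Hypothesis f_lower : forall s : R, 0 < s -> c1 * s `^ beta <= `|f s|.

Definition log_nonlin (t : R) : R := f (expR t) * expR (- t).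
Definition log_nonlin1 (t : R) : R := (f^`())%classic (expR t) - log_nonlin t.

Lemma pd_log_nonlin (t : R) : is_derive t (1 : R) log_nonlin (log_nonlin1 t).
Proof.
have df : is_derive (expR t) (1 : R) f ((f^`())%classic (expR t)).
  by rewrite derive1E; apply: derivableP; apply: f_derivable; exact: expR_gt0.
have dfe := is_derive_comp df (is_derive_expR t).
have de := pd_exp (pd_opp (is_derive_id t (1 : R))).
apply: (is_derive_eq (pd_mul dfe de)).
rewrite /log_nonlin1 /log_nonlin /= expRN; field.
by rewrite gt_eqF // expR_gt0.
Qed.

Lemma cts_log_nonlin1 : continuous log_nonlin1.
Proof.
apply: cts_add; last first.
  by apply: cts_opp; exact: (is_derive_continuous pd_log_nonlin).
move=> t; apply: (@continuous_comp _ _ _ (fun t => expR t) (f^`())%classic); first exact: continuous_expR.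
have op : open (`]0, +oo[%classic : set R) by exact: interval_open.
have := f'_cont; rewrite continuous_open_subspace // => h.
by apply: h; rewrite inE /= in_itv /= andbT expR_gt0.
Qed.

Lemma log_nonlin1_le t : log_nonlin1 t <= (beta - 1) * log_nonlin t.
Proof.
have := f_growth (expR_gt0 t); rewrite subr_ge0 => h0.
suff : (f^`())%classic (expR t) <= beta * log_nonlin t by rewrite /log_nonlin1; lra.
by rewrite /log_nonlin expRN mulrA ler_pdivlMr ?expR_gt0 // mulrC.
Qed.

Lemma log_nonlin_ge t : c1 * expR ((beta - 1) * t) <= `|log_nonlin t|.
Proof.
have := f_lower (expR_gt0 t); rewrite /powR gt_eqF ?expR_gt0 // expRK => h0.
rewrite /log_nonlin normrM (ger0_norm (expR_ge0 _)).
rewrite (_ : expR ((beta - 1) * t) = expR (beta * t) * expR (- t)); last first.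
  by rewrite -expRD; congr expR; ring.
by rewrite mulrA ler_pM2r // expR_gt0.
Qed.

(** The lower bound excludes zeros, so the intermediate value theorem fixes the sign. This separates
    the Bernstein case from the Keller-Osserman case. *)
Lemma log_nonlin_sign : (forall t, 0 < log_nonlin t) \/ (forall t, log_nonlin t < 0).
Proof.
have nz t : log_nonlin t != 0.
  rewrite -normr_gt0; apply: lt_le_trans (log_nonlin_ge t).
  by rewrite mulr_gt0 // expR_gt0.
have ch : continuous log_nonlin by exact: (is_derive_continuous pd_log_nonlin).
have same (s t : R) : s <= t -> 0 < log_nonlin s * log_nonlin t.
  move=> st; rewrite lt_neqAle eq_sym mulf_neq0 //= leNgt; apply/negP => neg.
  have [|c _ E] := IVT (f := log_nonlin) (v := 0) st (continuous_subspaceT ch).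
    rewrite ge_min le_max.
    have [s0|s0] := ltP (log_nonlin s) 0; have [t0|t0] := ltP (log_nonlin t) 0.
    - by move: neg; rewrite ltNge mulr_le0 // ltW.
    - by rewrite (ltW s0) orbT.
    - by rewrite (ltW t0) orbT.
    - by move: neg; rewrite ltNge mulr_ge0.
  by have := nz c; rewrite E eqxx.
have same0 t : 0 < log_nonlin 0 * log_nonlin t.
  by have [/same //|/ltW/same] := leP 0 t; rewrite mulrC.
have [h0|h0] := ltP 0 (log_nonlin 0); [left|right] => t; have := same0 t.
  by rewrite pmulr_rgt0.
by rewrite nmulr_rgt0 // lt_neqAle nz.
Qed.

End nonlinearity.

(** * Constant solutions, and reduction to the equation for [w = ln u] *)

Unset Implicit Arguments.

Theorem theorem1p5 (R : realType) (n : nat) (hn : (2 < n)%N)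
    (f : R -> R)
    (f_cont : {within `[0, +oo[, continuous f})
    (f_derivable : forall s : R, 0 < s -> derivable f s 1)
    (f'_cont : {within `]0, +oo[, continuous (f^`())%classic})
    (f_zero : exists s : R, 0 <= s /\ f s = 0)
    (beta : R) (beta_gt1 : 1 < beta)
    (beta_lt : beta < (n%:R + 2) / (n%:R - 2))
    (f_growth : forall s : R, 0 < s -> 0 <= beta * f s - s * (f^`())%classic s)
    (c1 : R) (c1_gt0 : 0 < c1)
    (f_lower : forall s : R, 0 < s -> c1 * s `^ beta <= `|f s|) :
  (~ exists u : 'rV[R]_n -> R,
       classical_solution f u /\ forall x, 0 < u x) /\
  (forall c : R, 0 <= c ->
     (classical_solution f (fun _ : 'rV[R]_n => c) <-> c = 0)).
Proof.
have n3 : 3 <= n%:R :> R by rewrite ler_nat.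
have f_nz (s : R) : 0 < s -> f s != 0.
  move=> s0; rewrite -normr_gt0; apply: lt_le_trans (f_lower s s0).
  by rewrite mulr_gt0 // powR_gt0.
split; last first.
  have dc (c : R) i : partial i (fun _ : 'rV[R]_n => c) = fun=> 0.
    by apply/funext => x; exact: derive_cst.
  have C1c (c : R) : C1 (fun _ : 'rV[R]_n => c).
    by move=> i; rewrite dc; split=> [x|]; [exact: derivable_cst|exact: cts_cst].
  have lap (c : R) x : laplacian (fun _ : 'rV[R]_n => c) x = 0.
    by rewrite /laplacian big1 // => i _; rewrite !dc.
  move=> c c0; split.
    move=> [_ /(_ 0)]; rewrite lap add0r => fc.
    move: c0; rewrite le_eqVlt => /predU1P[<- //|/f_nz].
    by rewrite fc eqxx.
  move=> ->; split; first by split=> // i; rewrite dc.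
  (* [f] does not vanish at positive arguments, so the zero supplied by [f_zero] is [0] itself. *)
  move=> x; rewrite lap add0r; have [s [s0 fs]] := f_zero.
  move: s0; rewrite le_eqVlt => /predU1P[s0|/f_nz]; first by rewrite {1}s0.
  by rewrite fs eqxx.
move=> [u [[[C1u C2u] sol] u0]].
pose u1 i := partial i u; pose u2 i j := partial i (partial j u).
have du i x : is_derive x 'e_i u (u1 i x) by apply: derivableP; exact: (C1u i).1.
have cu1 i : continuous (u1 i) by exact: (C1u i).2.
have du1 i j x : is_derive x 'e_i (u1 j) (u2 i j x).
  by apply: derivableP; exact: (C2u j i).1.
have cu2 i j : continuous (u2 i j) by exact: (C2u j i).2.
have cu : continuous u by exact: (partial_continuous du cu1).
pose v x := (u x)^-1.
have cv : continuous v.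
  by move=> x; exact: (cvgV (lt0r_neq0 (u0 x)) (cu x)).
have dv i x : is_derive x 'e_i v (- v x ^+ 2 * u1 i x).
  have u_nz : id (u x) != 0 by rewrite gt_eqF.
  have dinv := is_deriveV u_nz (is_derive_id (u x) (1 : R)).
  apply: (is_derive_eq (@is_derive_comp R _ (fun y : R => y^-1) u x _ _ _ dinv (du i x))).
  by rewrite [_ *: 1]mulr1 /v exprVn.
pose w x := ln (u x).
pose g i x := u1 i x * v x.
pose H i j x := u2 i j x * v x - g i x * g j x.
have dw i x : is_derive x 'e_i w (g i x).
  apply: (is_derive_eq (is_derive_comp (is_derive1_ln (u0 x)) (du i x))).
  by rewrite mulrC.
have dg i j x : is_derive x 'e_i (g j) (H i j x).
  apply: (is_derive_eq (pd_mul (du1 i j x) (dv i x))).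
  by rewrite /H /g; ring.
have cg i : continuous (g i) by exact: cts_mul.
have cH i j : continuous (H i j).
  by apply: cts_add; [exact: cts_mul|apply: cts_opp; exact: cts_mul].
have cw : continuous w by exact: (partial_continuous dw cg).
have ew x : expR (w x) = u x by rewrite lnK // posrE.
(* Dividing the equation by [u = expR w] produces [log_nonlin]; the squared gradient is the trace of
   the correction [g i * g j] in [H]. *)
have trH x : \sum_i H i i x = - (\sum_j g j x ^+ 2) - log_nonlin f (w x).
  rewrite sumrB -mulr_suml addrC; congr (_ + _).
  rewrite /log_nonlin expRN ew -mulNr; congr (_ * _).
  by apply/eqP; rewrite -addr_eq0; apply/eqP; exact: sol.
have b0 : 0 < beta - 1 by rewrite subr_gt0.
have bn : beta - 1 < 4 / (n%:R - 2).
  have -> : 4 / (n%:R - 2) = (n%:R + 2) / (n%:R - 2) - 1 :> R.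
    by field; rewrite gt_eqF //; lra.
  by rewrite ltrD2r.
have hge := log_nonlin_ge f_lower.
have [pos|neg] := log_nonlin_sign f_derivable c1_gt0 f_lower.
- apply: (no_positive_solution hn dw dg cH trH (pd_log_nonlin f_derivable)
    (cts_log_nonlin1 f_derivable f'_cont) b0 bn (log_nonlin1_le f_growth) c1_gt0).
  by move=> t; have := hge t; rewrite gtr0_norm.
- apply: (keller_osserman dw (fun i x => dg i i x) cw trH c1_gt0 b0).
  by move=> t; have := hge t; rewrite ltr0_norm.
Qed.
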